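(* For every integer $j\ge 4$ and every integer $k\ge 2$, the cycle $C_j$ is not a $k$-MSP graph.
   Context: All graphs are finite and simple. Polygons are simple polygons (closed planar regions without holes); angles equal to $\pi$ are not considered vertices. The direction of a line segment in the plane is the angle it makes with the $x$-axis. For an integer $k>1$, an allowed direction (with respect to $k$) is one in $\{ i\pi/k : 0\le i<k\}$. A $k$-lizard is a polygon all of whose sides have allowed directions with respect to $k$ (side lengths are arbitrary). A scale of a $k$-lizard $L$ is a maximal convex $k$-lizard contained in $L$: a convex $k$-lizard $S\subseteq L$ such that whenever $T$ is a convex $k$-lizard with $S\subseteq T\subseteq L$, $T=S$. A graph $G$ is a $k$-MSP graph if there exist a $k$-lizard $L$ and a bijection between the vertices of $G$ and the scales of $L$ such that two vertices of $G$ are adjacent if and only if the interiors of the corresponding scales intersect. *)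

(* Defs.v *)
From HB Require Import structures.
From mathcomp Require Import all_boot all_order all_algebra.
From mathcomp Require Import all_classical all_reals all_analysis.

Set Implicit Arguments.
Unset Strict Implicit.
Unset Printing Implicit Defensive.

Import Order.TTheory GRing.Theory Num.Theory.
Import numFieldNormedType.Exports.

Local Open Scope classical_set_scope.
Local Open Scope ring_scope.

Record sgraph := SGraph {
  svertex :> finType;
  sedge : rel svertex;
  sedge_sym : symmetric sedge;
  sedge_irrefl : irreflexive sedge }.

(* [ordS] is the successor modulo [n]; the conjunct [u != v] only matters for
   [n <= 1] and is there so that [cycle_graph] is defined for every [n]. *)
Definition cycle_rel n : rel 'I_n :=
  fun u v => (u != v) && ((v == ordS u) || (u == ordS v)).

Lemma cycle_rel_sym n : symmetric (@cycle_rel n).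
Proof. by move=> u v; rewrite /cycle_rel eq_sym orbC. Qed.

Lemma cycle_rel_irrefl n : irreflexive (@cycle_rel n).
Proof. by move=> u; rewrite /cycle_rel eqxx. Qed.

Definition cycle_graph n : sgraph :=
  SGraph (@cycle_rel_sym n) (@cycle_rel_irrefl n).

Notation plane R := (R^o * R^o)%type.

Section Polygons.
Context {R : realType}.
Implicit Types (p q : plane R) (L S T : set (plane R)).

Definition seg p q : set (plane R) :=
  [set (1 - t) *: p + t *: q | t in `[0%R, 1%R]].

(* The closed polygonal chain with vertices [v 0, ..., v (n - 1)] is simple.
   The last clause says that the angle at [v (i + 1)] is not pi, so that the
   [v i] are exactly the vertices and the [side v i] exactly the sides. *)
Definition side n (v : 'I_n -> plane R) (i : 'I_n) : set (plane R) :=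
  seg (v i) (v (ordS i)).

Definition simple_chain n (v : 'I_n -> plane R) : Prop :=
  [/\ (3 <= n)%N,
      injective v,
      forall i j, i != j ->
        side v i `&` side v j `<=`
          [set v i; v (ordS i)] `&` [set v j; v (ordS j)] &
      forall i, ~ seg (v i) (v (ordS (ordS i))) (v (ordS i))].

Definition chain_curve n (v : 'I_n -> plane R) : set (plane R) :=
  \bigcup_(i in [set: 'I_n]) side v i.

(* The curve together with the bounded components of its complement; for a
   simple chain there is exactly one such component (Jordan). *)
Definition chain_region n (v : 'I_n -> plane R) : set (plane R) :=
  chain_curve v `|`
  [set p | ~ chain_curve v p /\
           bounded_set (connected_component (~` chain_curve v) p)].

Definition has_direction p q (theta : R) : Prop :=
  0 <= theta < pi /\
  exists2 r : R, r != 0 & q - p = r *: ((cos theta, sin theta) : plane R).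

Definition allowed_direction (k : nat) (theta : R) : Prop :=
  exists2 i : nat, (i < k)%N & theta = i%:R * pi / k%:R.

Definition k_lizard (k : nat) L : Prop :=
  exists n (v : 'I_n -> plane R),
    [/\ simple_chain v,
        L = chain_region v &
        forall i, exists2 theta,
          has_direction (v i) (v (ordS i)) theta & allowed_direction k theta].

Definition convex_k_lizard (k : nat) S : Prop := k_lizard k S /\ convex_set S.

Definition scale (k : nat) L S : Prop :=
  [/\ convex_k_lizard k S, S `<=` L &
      forall T, convex_k_lizard k T -> S `<=` T -> T `<=` L -> T = S].

End Polygons.

Definition k_MSP_graph (R : realType) (k : nat) (G : sgraph) : Prop :=
  exists L : set (plane R), k_lizard k L /\
  exists f : G -> set (plane R),
    set_bij [set: G] [set S | scale k L S] f /\
    forall u v : G, u != v ->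
      (sedge u v <-> (interior (f u) `&` interior (f v)) !=set0).

(* Main.v *)
Require Import Defs.
From mathcomp Require Import all_boot all_order all_algebra.
From mathcomp Require Import all_classical all_reals all_analysis.
From mathcomp Require Import ring lra zify.

Set Implicit Arguments.
Unset Strict Implicit.
Unset Printing Implicit Defensive.

Import Order.TTheory GRing.Theory Num.Theory.
Import numFieldNormedType.Exports.

Local Open Scope classical_set_scope.
Local Open Scope ring_scope.

(* Let U_i be the interior of the i-th scale of L. Every interior point of L
   lies in a small convex lizard inside L, and by Zorn's lemma this lizard is
   contained in a scale, so the open convex sets U_i cover the interior of L;
   the nerve of this cover is a cycle of length j >= 4. Such a union has a hole:
   U_0 meets the rest of the union in two disjoint convex sets, a line
   separating them cuts U_0 in a chord, and the two ends q, q' of this chord lie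
   outside all the U_i. A closed polygon with one edge in each U_i crosses the
   chord exactly once, so q and q' have different crossing parities with respect
   to it. But q and q' are limits of points of the complement of L, which is
   connected and avoids the polygon: a contradiction.

   The application of Zorn's lemma rests on a description of convex lizards:
   they are the bounded intersections, with nonempty interior, of half-planes
   with allowed directions. If the constraints of such an intersection are
   tight, consecutive bounding lines meet in its vertices, some of which may
   coincide; conversely, a point outside a convex lizard is separated from it by
   the line of one of its sides. *)

(** * Complement of a closed bounded planar set *)

(** The Jordan curve theorem is avoided. A chain region is the curve together with the bounded
    components of its complement, so what lies outside is the single unbounded component; and the
    polygon of the parity argument may cross itself, because ray parity is locally constant off any
    closed polygon. The bound j >= 4 makes the two neighbours of U_0 disjoint; for j = 3 they may
    meet, and no line need separate their traces on U_0. The ends of the chord are limits of outer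
    points because the U_i cover the whole interior of L: the complement of their union is then the
    closure of the complement of L. The allowed directions enter only through this covering. *)

Section PlaneTopology.
Context {R : realType}.
Implicit Types (p q x y d : plane R) (A C : set (plane R)).

Definition affine (a b c : R) p : R := a * (p.1 : R) + b * (p.2 : R) + c.

Lemma affine_continuous a b c : continuous (affine a b c : plane R -> R^o).
Proof.
move=> p; rewrite /affine; apply: cvgD; last exact: cvg_cst.
by apply: cvgD; apply: cvgM; (exact: cvg_cst) || (exact: cvg_fst) ||
  (exact: cvg_snd).
Qed.

Lemma affine_gt0_near a b c p :
  0 < affine a b c p -> \forall q \near p, 0 < affine a b c q.
Proof. by move=> h; have /cvgr_gt/(_ _ h) := @affine_continuous a b c p. Qed.

Lemma path_continuous x y :
  continuous (fun t : R^o => (1 - t) *: x + t *: y : plane R).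
Proof.
move=> t; apply: cvgD; apply: cvgZr_tmp; last exact: cvg_id.
by apply: cvgB; [exact: cvg_cst|exact: cvg_id].
Qed.

Lemma segP x y p :
  seg x y p <-> exists t : R, 0 <= t <= 1 /\ p = (1 - t) *: x + t *: y.
Proof.
split=> [[t /=]|[t [t01 ->]]]; rewrite ?in_itv /=; first by move=> t01 <-;
  exists t.
by exists t => //=; rewrite in_itv.
Qed.

Lemma convex_setP A : convex_set A <->
  forall x y (t : R), A x -> A y -> 0 <= t <= 1 -> A ((1 - t) *: x + t *: y).
Proof.
split=> [cA x y t Ax Ay t01|cA x y l].
  have := cA y x (Itv01 (proj1 (andP t01)) (proj2 (andP t01))) (mem_set Ay)
    (mem_set Ax).
  by rewrite inE /conv /= /convex.conv /= addrC.
rewrite !inE => Ax Ay; have := cA y x l%:num Ay Ax.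
by rewrite addrC; apply; apply/andP; split.
Qed.

Lemma convex_seg A x y : convex_set A -> A x -> A y -> seg x y `<=` A.
Proof. by move=> /convex_setP cA Ax Ay p /segP[t [t01 ->]]; exact: cA. Qed.

Lemma seg_connected x y : connected (seg x y).
Proof.
apply: connected_continuous_connected; first exact: segment_connected.
by apply: continuous_subspaceT; exact: path_continuous.
Qed.

Lemma seg_compact x y : compact (seg x y).
Proof.
apply: continuous_compact; last exact: segment_compact.
by apply: continuous_subspaceT; exact: path_continuous.
Qed.

Lemma seg0 x y : seg x y x.
Proof. by apply/segP; exists 0;
  rewrite lexx ler01 subr0 scale1r scale0r addr0. Qed.

Lemma seg1 x y : seg x y y.
Proof. by apply/segP; exists 1;
  rewrite lexx ler01 subrr scale1r scale0r add0r. Qed.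

Lemma convex_connected A : convex_set A -> connected A.
Proof.
move=> cA; have [[x Ax]|A0] := pselect (A !=set0); last first.
  by have -> : A = set0 by [apply/eqP/negPn/negP => /set0P]; exact: connected0.
have -> : A = \bigcup_(y in A) seg x y.
  apply/seteqP; split=> [y Ay|y [z Az]]; first by exists y => //; exact: seg1.
  exact: convex_seg.
apply: bigcup_connected => [|y _]; last exact: seg_connected.
by exists x => y _; exact: seg0.
Qed.

Lemma convex_comb_gt0 (t a b : R) : 0 <= t <= 1 -> 0 < a -> 0 < b ->
  0 < (1 - t) * a + t * b.
Proof.
move=> /andP[t0 t1] a0 b0; have [t1'|t1'] := ltP t 1.
  by rewrite ltr_pwDl ?mulr_ge0 ?mulr_gt0 ?subr_gt0// ltW.
by have -> : t = 1; [lra|rewrite subrr mul0r add0r mul1r].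
Qed.

Lemma ball_convex p (e : R) : convex_set (ball p e).
Proof.
apply/convex_setP => x y t; rewrite -!ball_normE /ball_ /= =>
  hx hy /andP[t0 t1].
have -> : p - ((1 - t) *: x + t *: y) = (1 - t) *: (p - x) + t *: (p - y).
  by rewrite !scalerBr addrACA -scalerDl subrK scale1r opprD.
apply: le_lt_trans (ler_normD _ _) _; rewrite !normrZ !ger0_norm ?subr_ge0//.
have [->|tn0] := eqVneq t 0; first by rewrite subr0 mul1r mul0r addr0.
have tp : 0 < t by rewrite lt_neqAle eq_sym tn0.
have -> : e = (1 - t) * e + t * e by rewrite -mulrDl subrK mul1r.
by rewrite ler_ltD ?ltr_pM2l// ler_wpM2l ?subr_ge0// ltW.
Qed.

Lemma plane_normE p : `|p| = Num.max `|p.1 : R| `|p.2 : R|.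
Proof. by []. Qed.

Lemma nbhs_squareP p A : nbhs p A <->
  exists2 e : R, 0 < e &
    forall q, `|(q.1 : R) - p.1| < e -> `|(q.2 : R) - p.2| < e -> A q.
Proof.
split=> [/nbhs_ballP[e /= e0 h]|[e e0 h]].
  by exists e => // q h1 h2; apply: h; split;
    rewrite -ball_normE /ball_ /= distrC.
apply/nbhs_ballP; exists e => //= q [].
rewrite -!ball_normE /ball_ /= => h1 h2; apply: h; by rewrite distrC.
Qed.

Lemma bounded_planeP A : bounded_set A <->
  exists r : R, forall p, A p -> `|p.1 : R| <= r /\ `|p.2 : R| <= r.
Proof.
split=> [[r [_ h]]|[r h]].
  exists (r + 1) => p Ap; have := h (r + 1) (ltr_pwDr ltr01 (lexx r)) p Ap.
  by rewrite /= plane_normE ge_max => /andP.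
exists r; split=> [|s rs p Ap]; first exact: num_real.
have [h1 h2] := h p Ap.
by rewrite /= plane_normE ge_max !(le_trans _ (ltW rs)).
Qed.

(* [chain_region v] is [fill (chain_curve v)]. *)
Definition fill C : set (plane R) :=
  C `|` [set p | ~ C p /\ bounded_set (connected_component (~` C) p)].

Lemma halfplane_convex (a b c : R) : convex_set [set p | 0 < affine a b c p].
Proof.
apply/convex_setP => x y t; rewrite /affine /= => hx hy t01.
have -> : a * ((1 - t) * x.1 + t * y.1) + b * ((1 - t) * x.2 + t * y.2) + c
  = (1 - t) * (a * x.1 + b * x.2 + c) + t * (a * y.1 + b * y.2 + c) :> R by
    ring.
exact: convex_comb_gt0.
Qed.

(** Four open half-planes are added one at a time; each witness is a point that the new one shares
    with an earlier one. *)
Lemma far_connected (r : R) : connected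
  [set p | r < `|p.1 : R| \/ r < `|p.2 : R|].
Proof.
have hc a b c : connected [set p | 0 < affine a b c p].
  exact: convex_connected (@halfplane_convex a b c).
have -> : [set p | r < `|p.1 : R| \/ r < `|p.2 : R|] =
  [set p | 0 < affine 1 0 (- r) p] `|` [set p | 0 < affine 0 1 (- r) p]
  `|` [set p | 0 < affine (-1) 0 (- r) p] `|`
    [set p | 0 < affine 0 (-1) (- r) p].
  apply/seteqP; split=> p; rewrite /affine /=.
  rewrite !ltr_normr => -[/orP[]|/orP[]] h;
    [do 3 left| left; right|do 2 left; right|right]; lra.
  rewrite !ltr_normr => -[[[]|]|] h; [left|right|left|right]; apply/orP;
    by [left; lra|right; lra].
apply: connectedU; [by exists (- r - 1, - r - 1); split; [right|];
  rewrite /affine /=; lra| |exact: hc].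
apply: connectedU; [by exists (- r - 1, r + 1); split; [right|];
  rewrite /affine /=; lra| |exact: hc].
apply: connectedU; [|exact: hc|exact: hc].
by exists (r + 1, r + 1); split; rewrite /affine /=; lra.
Qed.

Section Fill.
Variable C : set (plane R).
Hypotheses (Cclosed : closed C) (Cbounded : bounded_set C).

Lemma component_nbhs p : ~ C p -> \forall q \near p,
  connected_component (~` C) p q.
Proof.
move=> Cp; have : nbhs p (~` C) by apply: open_nbhs_nbhs; split => //;
  exact: closed_openC.
move=> /nbhs_ballP[e /= e0 h]; apply/nbhs_ballP; exists e => //.
apply: connected_component_max => //; first exact: ballxx.
exact/convex_connected/ball_convex.
Qed.

Lemma fill_interior p : fill C p -> ~ C p -> (fill C)^° p.
Proof.
move=> [//|[_ pb] nCp].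
near=> q; right.
have cpq : connected_component (~` C) p q by near: q; exact: component_nbhs.
by rewrite /= -(same_connected_component cpq); split=> //;
  exact: connected_component_sub cpq.
Unshelve. all: by end_near. Qed.

(** A point outside [fill C] has an unbounded component, which must leave a square containing [C];
    the points beyond the square are connected, so there is only one such component. *)
Lemma fillNP : exists p0 (r : R),
  (forall p, ~ fill C p <-> connected_component (~` C) p0 p) /\
  (forall p, r < `|p.1 : R| \/ r < `|p.2 : R| ->
    connected_component (~` C) p0 p).
Proof.
have [r hr] := (bounded_planeP _).1 Cbounded.
have farC : [set p | r < `|p.1 : R| \/ r < `|p.2 : R|] `<=` ~` C.
  by move=> p /= + /hr[]; rewrite !ltNge => -[/negP|/negP].
have far0 : [set p | r < `|p.1 : R| \/ r < `|p.2 : R|] (`|r| + 1, 0).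
  by left; rewrite /= ger0_norm ?addr_ge0// ltr_pwDr// ler_norm.
have farc p : (r < `|p.1 : R| \/ r < `|p.2 : R|) ->
    connected_component (~` C) (`|r| + 1, 0) p.
  move=> rp; apply: (connected_component_max far0 farC) => //.
  exact: far_connected.
exists (`|r| + 1, 0), r; split=> // p; split=> [np|cp].
  have nCp : ~ C p by move=> ?; apply: np; left.
  have : exists q, connected_component (~` C) p q /\
    (r < `|q.1 : R| \/ r < `|q.2 : R|).
    apply: contrapT => nq; apply: np; right; split=> //; apply/bounded_planeP.
    by exists r => q cq; split; rewrite leNgt; apply/negP => rq; apply: nq;
      exists q; split=> //; [left|right].
  move=> [q [cpq /farc]] cq; apply: (connected_component_trans cq).
  exact: connected_component_sym.
have nCp := connected_component_sub cp.
case=> // -[_]; rewrite -(same_connected_component cp) => /bounded_planeP[s hs].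
have := hs (Num.max `|r| `|s| + 1, 0).
case; first apply: farc; rewrite /=.
  left; rewrite ger0_norm; last by rewrite addr_ge0// le_max normr_ge0.
  by rewrite ltr_pwDr// le_max ler_norm.
rewrite ger0_norm; last by rewrite addr_ge0// le_max normr_ge0.
rewrite leNgt ltr_pwDr// le_max. by rewrite ler_norm orbT.
Qed.

Lemma fill_closed : closed (fill C).
Proof.
rewrite -[fill C]setCK; apply: open_closedC; rewrite openE => p np.
have [p0 [r [h0 far0]]] := fillNP; have c0 := (h0 p).1 np.
have := component_nbhs (connected_component_sub c0).
apply: filterS => q cpq; apply/h0; exact: connected_component_trans c0 cpq.
Qed.

Lemma fillC_connected : connected (~` fill C).
Proof.
have [p0 [r [h0 far0]]] := fillNP.
have -> : ~` fill C = connected_component (~` C) p0.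
  by apply/seteqP; split=> p /h0.
exact: component_connected.
Qed.

Lemma fill_bounded : bounded_set (fill C).
Proof.
have [p0 [r [h0 far0]]] := fillNP.
apply/bounded_planeP; exists r => p fp.
by split; rewrite leNgt; apply/negP => rp; apply: (h0 p).2 fp; apply: far0;
  [left|right].
Qed.

End Fill.

End PlaneTopology.

(** * Parity of ray crossings *)

Section Parity.
Context {R : realType}.
Implicit Types (p q x y a b d w : plane R) (A C : set (plane R)).

Definition det x y : R := (x.1 : R) * y.2 - (x.2 : R) * y.1.
Definition dot x y : R := (x.1 : R) * y.1 + (x.2 : R) * y.2.

Lemma plane_eq p q : (p.1 : R) = q.1 -> (p.2 : R) = q.2 -> p = q.
Proof. by case: p q => [p1 p2] [q1 q2] /= -> ->. Qed.

Lemma det_inj d e x y : det d e != 0 -> det d x = det d y -> det e x =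
  det e y ->
  x = y.
Proof.
move=> de dx ex; have h1 : ((x.1 : R) - y.1) * det d e = 0.
  have -> : ((x.1 : R) - y.1) * det d e =
    e.1 * (det d x - det d y) - d.1 * (det e x - det e y) by rewrite /det; ring.
  by rewrite dx ex !subrr !mulr0 subrr.
have h2 : ((x.2 : R) - y.2) * det d e = 0.
  have -> : ((x.2 : R) - y.2) * det d e =
    e.2 * (det d x - det d y) - d.2 * (det e x - det e y) by rewrite /det; ring.
  by rewrite dx ex !subrr !mulr0 subrr.
move/eqP: h1; rewrite mulf_eq0 (negbTE de) orbF subr_eq0 => /eqP h1.
move/eqP: h2; rewrite mulf_eq0 (negbTE de) orbF subr_eq0 => /eqP h2.
exact: plane_eq.
Qed.

Lemma det_conv d x y (t : R) :
  det d ((1 - t) *: x + t *: y) = (1 - t) * det d x + t * det d y.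
Proof. by rewrite /det /= /GRing.scale /=; ring. Qed.

Lemma dot_gt0 d : d != 0 -> 0 < dot d d.
Proof.
move=> d0; rewrite lt_neqAle eq_sym /dot; apply/andP; split; last first.
  by rewrite addr_ge0// -expr2 sqr_ge0.
apply: contra d0; rewrite paddr_eq0 -?expr2 ?sqr_ge0// !sqrf_eq0 =>
  /andP[/eqP h1 /eqP h2].
by apply/eqP/plane_eq.
Qed.

Lemma affine_sign_near (a b c : R) p : affine a b c p != 0 ->
  \forall q \near p, (0 < affine a b c q) = (0 < affine a b c p).
Proof.
rewrite neq_lt => /orP[h|h].
  have : 0 < affine (- a) (- b) (- c) p by move: h; rewrite /affine; lra.
  move=> /affine_gt0_near; apply: filterS => q; move: h;
    rewrite /affine => h h'.
  apply/idP/idP; lra.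
by have := affine_gt0_near h; apply: filterS => q ->; rewrite h.
Qed.

Variable d : plane R.

(* Whether the edge from [a] to [b] meets a fixed one of the two open half-lines
   from [p] along [d]; vertices on the line count as lying on its same side, so
   that a half-line through a vertex is counted correctly. *)
Definition crosses p a b : bool :=
  ((det d p < det d a) (+) (det d p < det d b)) &&
  ((0 < det (a - p) (b - p)) == (det d p < det d a)).

Lemma level_near p a : det d p != det d a ->
  \forall q \near p, (det d q < det d a) = (det d p < det d a).
Proof.
have E q : (det d q < det d a) = (0 < affine (d.2 : R) (- d.1) (det d a) q).
  by rewrite -subr_gt0; congr (_ < _); rewrite /affine /det; ring.
move=> h; have : affine (d.2 : R) (- d.1) (det d a) p != 0.
  apply: contra h => /eqP h.
  by rewrite -subr_eq0 -oppr_eq0 opprB -h; apply/eqP; rewrite /affine /det;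
    ring.
by move=> /affine_sign_near; apply: filterS => q; rewrite !E.
Qed.

Lemma det_near p a b : det (a - p) (b - p) != 0 ->
  \forall q \near p, (0 < det (a - q) (b - q)) = (0 < det (a - p) (b - p)).
Proof.
have E q : det (a - q) (b - q) =
  affine ((a.2 : R) - b.2) ((b.1 : R) - a.1) (det a b) q.
  by rewrite /affine /det /=; ring.
by rewrite E => /affine_sign_near; apply: filterS => q; rewrite !E.
Qed.

Lemma seg_of_det p a b : det d a != det d b -> det (a - p) (b - p) = 0 ->
  (det d a <= det d p <= det d b) || (det d b <= det d p <= det d a) ->
  seg a b p.
Proof.
move=> ab D0 hp; apply/segP.
exists ((det d p - det d a) / (det d b - det d a)).
have ba0 : det d b - det d a != 0 by rewrite subr_eq0 eq_sym.
split.
  case/orP: hp => /andP[h1 h2].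
    have ba : 0 < det d b - det d a by rewrite lt_neqAle eq_sym ba0 subr_ge0
      (le_trans h1).
    rewrite divr_ge0 ?subr_ge0// ?(le_trans h1)//= ler_pdivrMr// mul1r; lra.
  have ba : det d b - det d a < 0 by rewrite lt_neqAle ba0 subr_le0
    (le_trans h1).
  by rewrite ler_ndivlMr// ler_ndivrMr// mul0r mul1r; lra.
have de : det d (b - a) != 0 by move: ba0; congr (_ != _); rewrite /det /=;
  ring.
apply: (det_inj de); rewrite det_conv; first by field.
transitivity (det b a + det (a - p) (b - p)); first by rewrite /det /=; ring.
by rewrite D0; set t := _ / _; rewrite /det /=; ring.
Qed.

Hypothesis d0 : d != 0.

Lemma seg_of_level p a b : det d a = det d p -> det d b = det d p ->
  (dot d (a - p) < 0) (+) (dot d (b - p) < 0) -> seg a b p.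
Proof.
move=> ap bp hu; apply/segP.
set u := dot d (a - p) in hu; set v := dot d (b - p) in hu.
have uv : u - v != 0.
  by apply: contraTneq hu => /subr0_eq ->; rewrite addbb.
exists (u / (u - v)); split.
  move: hu; case: ltP => hu; case: ltP => hv //= _.
    have uv0 : u - v < 0 by lra.
    by rewrite ler_ndivlMr// ler_ndivrMr// mul0r mul1r; lra.
  have uv0 : 0 < u - v by lra.
  by rewrite ler_pdivlMr// ler_pdivrMr// mul0r mul1r; lra.
apply: (@det_inj d (- d.2 , d.1)).
- by rewrite {1}/det /= mulrN opprK; move/gt_eqF: (dot_gt0 d0) => /negbT.
- by rewrite det_conv ap bp; ring.
- have -> x : det (- d.2, d.1) x = - dot d x by rewrite /det /dot /=; ring.
  have -> x : det (- d.2, d.1) x = - dot d x by rewrite /det /dot /=; ring.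
  congr (- _); apply/eqP; rewrite -subr_eq0; apply/eqP.
  have -> t : dot d p - dot d ((1 - t) *: a + t *: b) = - ((1 - t) * u + t * v).
    by rewrite /u /v /dot /= /GRing.scale /=; ring.
  by field.
Qed.

(* Near [p], the crossing indicator of an edge jumps only if an end [a] lies on
   the line through [p] directed by [d]; [vertex_jump] is that jump, so that
   the jumps cancel when two edges meet at [a]. *)
Definition vertex_jump p q a : bool :=
  [&& det d a == det d p, det d q < det d a & dot d (a - p) < 0].

(** Cases on which ends lie on the line through [p]. If both do, the edge is never counted, and [p]
    does not separate the ends, so their jumps agree. If one does, the side test is constant near
    [p] and only the level test of that end can jump. If none does, nothing changes. *)
Lemma crosses_near p a b : ~ seg a b p ->
  \forall q \near p, crosses q a b (+) crosses p a b =
    vertex_jump p q a (+) vertex_jump p q b.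
Proof.
move=> nab.
(* When one end is on the line through [p], a term vanishes, and the side test is decided by the
   position of that end along [d] and the level of the other end. *)
have detE x y : det (x - p) (y - p) * dot d d =
  dot d (x - p) * (det d y - det d p)
    - (det d x - det d p) * dot d (y - p) by rewrite /det /dot /=; ring.
have sgnD x y : (0 < det (x - p) (y - p)) = (0 < det (x - p) (y - p) * dot d d).
  by rewrite pmulr_lgt0 ?dot_gt0.
have [pa|pa] := eqVneq (det d a) (det d p); have [pb|pb] :=
  eqVneq (det d b) (det d p).
- have h := seg_of_level pa pb; near=> q; move: h.
  rewrite /vertex_jump /crosses pa pb eqxx addbb andFb andTb.
  case: (dot d (a - p) < 0); case: (dot d (b - p) < 0) => h;
    rewrite ?andbF ?addbb//=;
    by case: nab; apply: h.
- have D0 : det (a - p) (b - p) != 0.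
    apply/eqP => D0; apply: nab; apply: seg_of_det => //;
      first by rewrite pa eq_sym.
    by rewrite -pa !lexx /= andbT le_total.
  near=> q; rewrite /vertex_jump /crosses pa (negbTE pb) eqxx /= addbF.
  have -> : (det d q < det d b) = (det d p < det d b).
    by near: q; apply: level_near; rewrite eq_sym.
  have -> : (0 < det (a - q) (b - q)) = (0 < det (a - p) (b - p)).
    by near: q; exact: det_near.
  rewrite ltxx; have dq : dot d (a - p) != 0.
    have := mulf_neq0 D0 (lt0r_neq0 (dot_gt0 d0)).
    by rewrite detE pa subrr mul0r subr0; apply: contraNneq => ->;
      rewrite mul0r.
  rewrite sgnD detE pa subrr mul0r subr0.
  have := pb; rewrite neq_lt => /orP[lb|lb].
    rewrite (lt_gtF lb) nmulr_lgt0 ?subr_lt0//.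
    by case: (_ < _); case: (_ < _).
  rewrite lb pmulr_lgt0 ?subr_gt0//.
  have := dq; rewrite neq_lt => /orP[ld|ld]; rewrite ld (lt_gtF ld);
    by case: (_ < _).
- have D0 : det (a - p) (b - p) != 0.
    apply/eqP => D0; apply: nab; apply: seg_of_det => //; first by rewrite pb.
    by rewrite -pb !lexx /= !andbT le_total.
  near=> q; rewrite /vertex_jump /crosses pb (negbTE pa) eqxx /=.
  have -> : (det d q < det d a) = (det d p < det d a).
    by near: q; apply: level_near; rewrite eq_sym.
  have -> : (0 < det (a - q) (b - q)) = (0 < det (a - p) (b - p)).
    by near: q; exact: det_near.
  rewrite ltxx; have dq : dot d (b - p) != 0.
    have := mulf_neq0 D0 (lt0r_neq0 (dot_gt0 d0)).
    by rewrite detE pb subrr mulr0 sub0r; apply: contraNneq => ->;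
      rewrite mulr0 oppr0.
  rewrite sgnD detE pb subrr mulr0 sub0r -mulNr opprB.
  have := pa; rewrite neq_lt => /orP[la|la].
    rewrite (lt_gtF la) pmulr_rgt0 ?subr_gt0//.
    have := dq; rewrite neq_lt => /orP[ld|ld]; rewrite ld (lt_gtF ld);
      by case: (_ < _).
  rewrite la nmulr_rgt0 ?subr_lt0//.
  by case: (_ < _); case: (_ < _).
- have [AB|AB] := boolP ((det d p < det d a) (+) (det d p < det d b));
  last first.
    near=> q; rewrite /vertex_jump (negbTE pa) (negbTE pb) /= /crosses.
    have -> : (det d q < det d a) = (det d p < det d a).
      by near: q; apply: level_near; rewrite eq_sym.
    have -> : (det d q < det d b) = (det d p < det d b).
      by near: q; apply: level_near; rewrite eq_sym.
    by rewrite (negbTE AB).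
  have D0 : det (a - p) (b - p) != 0.
    move: AB; case: ltP => h1; case: ltP => h2 //= _; apply/eqP => D0;
      apply: nab; apply: seg_of_det => //.
    - by rewrite gt_eqF// (le_lt_trans h2).
    - by rewrite h2 (ltW h1) orbT.
    - by rewrite lt_eqF// (le_lt_trans h1).
    - by rewrite h1 (ltW h2).
  near=> q; rewrite /vertex_jump (negbTE pa) (negbTE pb) /= /crosses.
  have -> : (det d q < det d a) = (det d p < det d a).
    by near: q; apply: level_near; rewrite eq_sym.
  have -> : (det d q < det d b) = (det d p < det d b).
    by near: q; apply: level_near; rewrite eq_sym.
  have -> : (0 < det (a - q) (b - q)) = (0 < det (a - p) (b - p)).
    by near: q; exact: det_near.
  by rewrite addbb.
Unshelve. all: by end_near. Qed.

Definition parity n (g : 'I_n -> plane R) p : bool :=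
  \big[addb/false]_(i < n) crosses p (g i) (g (ordS i)).

Lemma parity_near n (g : 'I_n -> plane R) p : ~ chain_curve g p ->
  \forall q \near p, parity g q = parity g p.
Proof.
move=> gp; have edge i : ~ seg (g i) (g (ordS i)) p by move=> h; apply: gp;
  exists i.
have : \forall q \near p, forall i, crosses q (g i) (g (ordS i)) (+)
    crosses p (g i) (g (ordS i)) =
      vertex_jump p q (g i) (+) vertex_jump p q (g (ordS i)).
  have := @filter_forall _ _ (fun i q => crosses q (g i) (g (ordS i)) (+)
    crosses p (g i) (g (ordS i)) =
      vertex_jump p q (g i) (+) vertex_jump p q (g (ordS i)))
    (nbhs p) (nbhs_filter p).
  by apply => i; exact: crosses_near.
apply: filterS => q h; apply/eqP; rewrite -negb_add /parity -big_split /=.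
rewrite (eq_bigr _ (fun i _ => h i)) big_split /=.
by rewrite [X in X (+) _](reindex_inj (@ordS_inj n)) /= addbb.
Qed.

(** Since parity is constant near [p] and [q], points of the closure may be replaced with points of
    [A]; on [A] each parity class is relatively open, hence also relatively closed. *)
Lemma parity_connected n (g : 'I_n -> plane R) A : connected A ->
  A `&` chain_curve g = set0 ->
  forall p q, closure A p -> closure A q -> ~ chain_curve g p ->
    ~ chain_curve g q ->
  parity g p = parity g q.
Proof.
move=> cA Ag p q Ap Aq gp gq.
have [x [Ax xp]] := Ap _ (parity_near gp).
have [y [Ay yq]] := Aq _ (parity_near gq).
rewrite -xp -yq => {p q Ap Aq gp gq xp yq}.
have gA z : A z -> ~ chain_curve g z by move=> Az gz;
  rewrite -[False]/(set0 z) -Ag.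
have opn (b : bool) : exists2 D, open D & A `&` [set z | parity g z = b] =
  A `&` D.
  exists ([set z | parity g z = b]^°); first exact: open_interior.
  apply/seteqP; split=> z [Az h]; split=> //; last exact: interior_subset h.
  by have := parity_near (gA z Az); apply: filterS => w /= ->.
have : A `&` [set z | parity g z = parity g x] = A.
  apply: cA.
  - by exists x.
  - exact: opn.
  have [D oD e] := opn (~~ parity g x); exists (~` D);
    first exact: open_closedC.
  apply/seteqP; split=> z [Az h]; split=> //.
    move=> Dz; have : (A `&` D) z by [].
    by rewrite -e => -[_ /=]; rewrite h; case: (parity g x).
  apply: contrapT => h'; apply: h; suff : (A `&` D) z by case.
  rewrite -e; split=> //=; move: h' => /=; by case: (parity g z);
    case: (parity g x).
by move/seteqP => [_ /(_ y Ay)[_ ->]].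
Qed.

(** The level tests agree at [p] and [q], so the side test differs. The determinant behind it is
    affine along the segment and vanishes at parameter [t]; there the level test puts the point on
    the edge. *)
Lemma crosses_neq_meet p q a b : det d p = det d q ->
  crosses p a b != crosses q a b -> exists2 x, seg p q x & seg a b x.
Proof.
move=> pq; rewrite /crosses -pq.
have [AB|] := boolP ((det d p < det d a) (+) (det d p < det d b));
  last by rewrite eqxx.
rewrite /= => h.
have {}h : (0 < det (a - p) (b - p)) != (0 < det (a - q) (b - q)).
  by apply: contraNN h => /eqP ->.
pose t := det (a - p) (b - p) / (det (a - p) (b - p) - det (a - q) (b - q)).
have u0 : det (a - p) (b - p) - det (a - q) (b - q) != 0.
  by apply: contraNN h => /eqP/subr0_eq ->.
have t01 : 0 <= t <= 1.
  rewrite /t; move: h; case: ltP => h1; case: ltP => h2 //= _.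
    have uv0 : 0 < det (a - p) (b - p) - det (a - q) (b - q) by lra.
    by rewrite ler_pdivlMr// ler_pdivrMr// mul0r mul1r; lra.
  have uv0 : det (a - p) (b - p) - det (a - q) (b - q) < 0 by lra.
  by rewrite ler_ndivlMr// ler_ndivrMr// mul0r mul1r; lra.
exists ((1 - t) *: p + t *: q); first by apply/segP; exists t.
have lev : det d ((1 - t) *: p + t *: q) = det d p by rewrite det_conv -pq;
  ring.
apply: seg_of_det.
- by apply: contraTneq AB => ->; rewrite addbb.
- transitivity ((1 - t) * det (a - p) (b - p) + t * det (a - q) (b - q)).
    by rewrite /det /= /GRing.scale /=; ring.
  by rewrite /t; field.
- rewrite lev; move: AB; case: ltP => h1; case: ltP => h2 //= _.
    by rewrite ?h2 ?(ltW h1) ?orbT.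
  by rewrite ?h1 ?(ltW h2).
Qed.

(** At [z] the determinant of the side test is zero; a displacement [r *: d] changes it to a
    multiple of [r] by a nonzero constant, so its sign differs on the two sides of [z]. *)
Lemma crosses_through z a b (s s' : R) : 0 < s -> 0 < s' ->
  (det d z < det d a) (+) (det d z < det d b) -> det (a - z) (b - z) = 0 ->
  crosses (z + s *: d) a b (+) crosses (z - s' *: d) a b.
Proof.
move=> s0 s0' AB D0.
have lev r : det d (z + r *: d) = det d z by rewrite /det /= /GRing.scale /=;
  ring.
have DE r : det (a - (z + r *: d)) (b - (z + r *: d)) = r * (det d a - det d b).
  transitivity (det (a - z) (b - z) + r * (det d a - det d b)).
    by rewrite /det /= /GRing.scale /=; ring.
  by rewrite D0 add0r.
rewrite -scaleNr /crosses !lev !DE AB /= pmulr_rgt0// nmulr_rgt0 ?oppr_lt0//.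
move: AB; case: (ltP (det d z) (det d a)) => h1;
  case: (ltP (det d z) (det d b)) => h2 //= _.
  have h : 0 < det d a - det d b by lra.
  by rewrite h (lt_gtF h).
have h : det d a - det d b < 0 by lra.
by rewrite h (lt_gtF h).
Qed.

End Parity.

(** * Separation of open convex sets *)

Section Separation.
Context {R : realType}.
Implicit Types (p q x y a b d v w : plane R) (A B C : set (plane R)).

Lemma open_line A x v : open A -> A x ->
  exists2 e : R, 0 < e & forall s : R, `|s| < e -> A (x + s *: v).
Proof.
move=> oA Ax; have cf : continuous (fun s : R^o => x + s *: v : plane R).
  by move=> s; apply: cvgD; [exact: cvg_cst|apply: cvgZr_tmp; exact: cvg_id].
have : nbhs (0 : R^o) [set s | A (x + s *: v)].
  by apply: cf; rewrite scale0r addr0; exact: open_nbhs_nbhs.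
move=> /nbhs_ballP[e /= e0 h]; exists e => // s se; apply: h.
by rewrite -ball_normE /ball_ /= sub0r normrN.
Qed.

Lemma open_line1 A x v : open A -> A x -> exists2 e : R, 0 < e & A (x + e *: v).
Proof.
move=> oA Ax; have [e e0 h] := open_line v oA Ax; exists (e / 2);
  first by rewrite divr_gt0.
by apply: h; rewrite gtr0_norm ?divr_gt0//; lra.
Qed.

(* With [e] orthogonal to a point [c] of [A], the slopes [r] of the points
   [e + r c] of the cone over [A] and the opposites of the slopes [r] of its
   points [- e + r c] form a cut of the real line, whose cut point is the slope
   of the separating line. *)
Lemma separation0 A : convex_set A ->
  (forall x v, A x -> exists2 e : R, 0 < e & A (x + e *: v)) -> ~ A 0 ->
  exists2 d, d != 0 & forall x, A x -> 0 < det d x.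
Proof.
move=> /convex_setP cA oA A0.
have [[c Ac]|nA] := pselect (A !=set0); last first.
  exists (1, 0) => [|x Ax]; last by case: nA; exists x.
  by apply/eqP => -[/eqP]; rewrite oner_eq0.
have c0 : c != 0 by apply: contra_notN A0 => /eqP <-.
have cc := dot_gt0 c0.
pose e : plane R := (- c.2, c.1).
pose K x := exists2 s : R, 0 < s & A (s *: x).
have Kadd x y : K x -> K y -> K (x + y).
  move=> [s s0 Ax] [t t0 Ay]; have st : 0 < s + t by rewrite addr_gt0.
  exists (s * t / (s + t)); first by rewrite divr_gt0 ?mulr_gt0.
  have -> : (s * t / (s + t)) *: (x + y) = (1 - s / (s + t)) *: (s *: x) +
    (s / (s + t)) *: (t *: y).
    rewrite scalerDr !scalerA; congr (_ *: _ + _ *: _).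
      by field; rewrite gt_eqF.
    by field; rewrite gt_eqF.
  apply: cA => //; rewrite divr_ge0 ?(ltW s0) ?(ltW st)//= ler_pdivrMr// mul1r
    lerDl; exact: ltW.
have KA x : A x -> K x by move=> Ax; exists 1 => //; rewrite scale1r.
have Kscale x (s : R) : 0 < s -> K x -> K (s *: x).
  move=> s0 [t t0 Ax]; exists (t / s); first by rewrite divr_gt0.
  by rewrite scalerA divfK// gt_eqF.
have Kc (r : R) : K (r *: c) -> 0 < r.
  move=> [s s0]; rewrite scalerA => Asr; rewrite ltNge; apply/negP => r0.
  have sr : 0 < 1 - s * r by rewrite subr_gt0 (le_lt_trans _ ltr01)//
    pmulr_rle0.
  (* As [s * r <= 0], the origin lies on the segment from [c] to [(s * r) *: c], at this
     parameter. *)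
  apply: A0; have -> : 0 = (1 - 1 / (1 - s * r)) *: c +
    (1 / (1 - s * r)) *: ((s * r) *: c).
    rewrite scalerA -scalerDl.
    have -> : 1 - 1 / (1 - s * r) + 1 / (1 - s * r) * (s * r) =
      - s * r * 0 + 0 :> R.
      by field; rewrite gt_eqF.
    by rewrite mulr0 addr0 scale0r.
  apply: cA => //; apply/andP; split; first by rewrite divr_ge0// ltW.
  by rewrite ler_pdivrMr// mul1r; nra.
have NE : exists r : R, K (- e + r *: c).
  have [s s0 h] := oA c (- e) Ac; exists s^-1; exists s => //.
  by rewrite scalerDr scalerA mulfV ?gt_eqF// scale1r addrC.
have PE : exists r : R, K (e + r *: c).
  have [s s0 h] := oA c e Ac; exists s^-1; exists s => //.
  by rewrite scalerDr scalerA mulfV ?gt_eqF// scale1r addrC.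
have PN (r r' : R) : K (e + r *: c) -> K (- e + r' *: c) -> 0 < r + r'.
  by move=> h h'; apply: Kc; have := Kadd _ _ h h';
    rewrite addrACA subrr add0r scalerDl.
pose N := [set - r | r in [set r : R | K (- e + r *: c)]].
have Nub : has_sup N.
  split; first by have [r hr] := NE; exists (- r); exists r.
  have [r hr] := PE; exists r => _ [r' /= hr' <-].
  by have := PN _ _ hr hr'; lra.
pose l := sup N.
have lN (r : R) : K (- e + r *: c) -> - r <= l.
  by move=> h; apply: (sup_upper_bound Nub); exists r.
have lP (r : R) : K (e + r *: c) -> l <= r.
  move=> h; apply: sup_le_ub; first by case: Nub.
  by move=> _ [r' /= hr' <-]; have := PN _ _ h hr'; lra.
have dec x : x = (dot e x / dot c c) *: e + (dot c x / dot c c) *: c.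
  by apply: plane_eq; rewrite /dot /= /GRing.scale /=; field;
    move: (gt_eqF cc) => /negbT.
pose phi x := dot c x - l * dot e x.
have phi_ge0 x : A x -> 0 <= phi x.
  move=> Ax; rewrite /phi; have [s0|s0|s0] := ltgtP (dot e x) 0.
  - have := lN (dot c x / - dot e x); rewrite -mulNr ler_pdivrMr ?oppr_gt0//.
    suff h : K (- e + (dot c x / - dot e x) *: c) by move/(_ h); lra.
    have -> : - e + (dot c x / - dot e x) *: c = (dot c c / - dot e x) *: x.
      rewrite [X in _ = _ *: X](dec x) scalerDr !scalerA -scaleN1r;
        congr (_ *: _ + _ *: _); field.
        by rewrite ?oppr_eq0 ?(lt_eqF s0) ?(gt_eqF cc).
      by rewrite ?oppr_eq0 ?(lt_eqF s0) ?(gt_eqF cc).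
    by apply: Kscale; [rewrite divr_gt0// oppr_gt0|exact: KA].
  - have := lP (dot c x / dot e x); rewrite ler_pdivlMr//.
    suff h : K (e + (dot c x / dot e x) *: c) by move/(_ h); lra.
    have -> : e + (dot c x / dot e x) *: c = (dot c c / dot e x) *: x.
      rewrite [X in _ = _ *: X](dec x) scalerDr !scalerA
        -[X in X + _](scale1r e); congr (_ *: _ + _ *: _); field.
        by rewrite ?(gt_eqF s0) ?(gt_eqF cc).
      by rewrite ?(gt_eqF s0) ?(gt_eqF cc).
    by apply: Kscale; [rewrite divr_gt0|exact: KA].
  - rewrite s0 mulr0 subr0; have : K ((dot c x / dot c c) *: c).
      by have := KA x Ax; rewrite [X in K X](dec x) s0 mul0r scale0r add0r.
    move=> /Kc; by rewrite pmulr_lgt0 ?invr_gt0//; exact: ltW.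
(* The weak inequality becomes strict because [x] can be moved a little along [- c], where [phi]
   decreases. *)
have phi_gt0 x : A x -> 0 < phi x.
  move=> Ax; have [s s0 /phi_ge0] := oA x (- c) Ax.
  have -> : phi (x + s *: (- c)) = phi x - s * dot c c.
    by rewrite /phi /dot /= /GRing.scale /=; ring.
  have : 0 < s * dot c c by rewrite mulr_gt0.
  lra.
have phiE x : phi x = det ((c.2 : R) - l * e.2 , - (c.1 - l * e.1)) x.
  by rewrite /phi /dot /det /=; ring.
exists ((c.2 : R) - l * e.2 , - (c.1 - l * e.1)) => [|x /phi_gt0];
  last by rewrite phiE.
have := phi_gt0 c Ac; rewrite phiE; apply: contraTneq => ->.
by rewrite /det /= !mul0r subrr ltxx.
Qed.

(** [separation0] applies to the set of differences [y - x], and the level [f] is the supremum of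
    [det d] over [A]. Small moves along [v], where [det d] grows, or against it, make both
    inequalities strict. *)
Lemma separation A B : convex_set A -> convex_set B -> open A -> open B ->
  A !=set0 -> B !=set0 -> A `&` B = set0 ->
  exists d (f : R), [/\ d != 0, forall x, A x -> det d x < f & forall x,
    B x -> f < det d x].
Proof.
move=> /convex_setP cA /convex_setP cB oA oB A0 B0 AB.
have [] := @separation0 [set y - x | x in A & y in B].
- apply/convex_setP => _ _ t [x Ax [y By <-]] [x' Ax' [y' By' <-]] t01.
  exists ((1 - t) *: x + t *: x'); first exact: cA.
  exists ((1 - t) *: y + t *: y'); first exact: cB.
  by rewrite !scalerBr opprD addrACA.
- move=> _ v [x Ax [y By <-]]; have [e e0 h] := open_line1 v oB By.
  by exists e => //; exists x => //; exists (y + e *: v) => //; rewrite addrAC.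
- move=> [x Ax [y By /subr0_eq yx]]; rewrite -[False]/(set0 x) -AB; split => //.
  by rewrite -yx.
move=> d d0 h.
have hAB x y : A x -> B y -> det d x < det d y.
  move=> Ax By; have : 0 < det d (y - x) by apply: h; exists x => //; exists y.
  by have -> : det d (y - x) = det d y - det d x; [rewrite /det /=; ring|lra].
pose D := [set det d x | x in A].
have hD : has_sup D.
  split; first by have [x Ax] := A0; exists (det d x); exists x.
  by have [y By] := B0; exists (det d y) => _ [x Ax <-]; exact/ltW/hAB.
pose v : plane R := (- d.2, d.1).
have dv (s : R) x : det d (x + s *: v) = det d x + s * dot d d.
  by rewrite /det /dot /= /GRing.scale /=; ring.
exists d, (sup D); split=> // x.
  move=> Ax; have [e e0 Ae] := open_line1 v oA Ax.
  apply: (@lt_le_trans _ _ (det d (x + e *: v))).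
    by rewrite dv ltrDl mulr_gt0// dot_gt0.
  by apply: sup_upper_bound => //; exists (x + e *: v).
move=> Bx; have [e e0 Be] := open_line1 (- v) oB Bx.
apply: (@le_lt_trans _ _ (det d (x + e *: - v))).
  by apply: sup_le_ub; [case: hD|move=> _ [y Ay <-]; exact/ltW/hAB].
by rewrite scalerN -scaleNr dv gtrDl mulNr oppr_lt0 mulr_gt0// dot_gt0.
Qed.

End Separation.

(** * Cyclic nerves of open convex sets *)

Lemma ordSE n (i : 'I_n) :
  (i.+1 < n)%N /\ ordS i = i.+1 :> nat \/ i.+1 = n /\ ordS i = 0%N :> nat.
Proof.
have := ltn_ord i; rewrite leq_eqVlt => /orP[/eqP e|h].
  by right; split=> //=; rewrite e modnn.
by left; split=> //=; rewrite modn_small.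
Qed.

Lemma ordS_neq n (i : 'I_n) : (1 < n)%N -> ordS i != i.
Proof.
move=> n1; apply/eqP => /(congr1 (@nat_of_ord n)) e.
have [[_]|[h]] := ordSE i; rewrite e; first by move/eqP;
  rewrite -[X in X == _]addn0 -addn1 eqn_add2l.
by move=> i0; move: n1; rewrite -[X in (_ < X)%N]h i0.
Qed.

Lemma ordSS_neq n (i : 'I_n) : (2 < n)%N -> ordS (ordS i) != i.
Proof.
move=> n2; apply/eqP => /(congr1 (@nat_of_ord n)) e.
have := ltn_ord i; have [[_]|[h]] := ordSE (ordS i); have [[_]|[h']] :=
  ordSE i; lia.
Qed.

Section CyclicNerve.
Context {R : realType}.
Implicit Types (p q x y z d : plane R) (A M U : set (plane R)).

Lemma bounded_ray A z d : bounded_set A -> d != 0 ->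
  exists m : R, forall s : R, A (z + s *: d) -> s <= m.
Proof.
move=> /bounded_planeP[m hm] d0; have dd := dot_gt0 d0.
exists ((`|d.1 : R| * m + `|d.2 : R| * m - dot d z) / dot d d) => s Us.
rewrite ler_pdivlMr//; have [h1 h2] := hm _ Us.
have -> : s * dot d d = dot d (z + s *: d) - dot d z.
  by rewrite /dot /= /GRing.scale /=; ring.
by rewrite lerD2r /dot lerD//; apply: (le_trans (ler_norm _));
  rewrite normrM ler_wpM2l.
Qed.

(** The exit parameter is a supremum: openness keeps it from being attained, and convexity puts all
    earlier points in [U]. *)
Lemma chord_end U z d : open U -> convex_set U -> bounded_set U -> d != 0 ->
  U z ->
  exists2 r : R, 0 < r & ~ U (z + r *: d) /\ forall s : R, 0 <= s < r ->
    U (z + s *: d).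
Proof.
move=> oU /convex_setP cU bU d0 Uz; have [m hm] := bounded_ray z bU d0.
pose S := [set s : R | 0 <= s /\ U (z + s *: d)].
have hS : has_sup S.
  split; first by exists 0; split; rewrite // scale0r addr0.
  by exists m => s [_ /hm].
have [e e0 he] := open_line d oU Uz.
have Se : S (e / 2).
  by split; [rewrite ltW// divr_gt0|apply: he; rewrite gtr0_norm ?divr_gt0//;
    lra].
have r0 : 0 < sup S by apply: lt_le_trans (sup_upper_bound hS Se);
  rewrite divr_gt0.
exists (sup S) => //; split.
  move=> Ur; have [e' e'0 he'] := open_line1 d oU Ur.
  have : S (sup S + e') by split;
    [rewrite addr_ge0 ?ltW|rewrite scalerDl addrA].
  by move=> /(sup_upper_bound hS); rewrite leNgt ltrDl e'0.
move=> s /andP[s0 sr].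
have [s1 [s10 Us1] ss1] := @sup_adherent _ S (sup S - s)
  ltac:(by rewrite subr_gt0) hS.
rewrite subKr in ss1.
have s1p : 0 < s1 by apply: le_lt_trans ss1.
have -> : z + s *: d = (1 - s / s1) *: z + (s / s1) *: (z + s1 *: d).
  by rewrite scalerDr addrA -scalerDl subrK scale1r scalerA divfK ?gt_eqF.
apply: cU => //; rewrite divr_ge0 ?(ltW s1p)//= ler_pdivrMr// mul1r; exact: ltW.
Qed.

Lemma cyclic_nerve_hole j (U : 'I_j -> set (plane R)) M : (4 <= j)%N ->
  (forall i, open (U i)) -> (forall i, convex_set (U i)) ->
  (forall i, bounded_set (U i)) ->
  (forall i l, i != l -> cycle_rel i l <-> (U i `&` U l !=set0)) ->
  connected M -> closure M = ~` (\bigcup_i U i) -> False.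
Proof.
move=> j4 oU cU bU nU cM hM.
have j0 : (0 < j)%N by apply: leq_trans j4.
pose i0 := Ordinal j0.
pose nx := ordS i0; pose pr := ord_pred i0.
have nxE : nx = 1%N :> nat by rewrite /= modn_small// (leq_trans _ j4).
have prE : pr = j.-1 :> nat by rewrite /= modn_small// prednK.
have neqS (i : 'I_j) : ordS i != i by apply: ordS_neq; exact: leq_trans j4.
have adj i : U i `&` U (ordS i) !=set0.
  by apply/nU; rewrite /cycle_rel ?eqxx eq_sym ?neqS.
(* The indices [j.-1] and [1] are not consecutive modulo [j], because [4 <= j]. *)
have pr_nx : U pr `&` U nx = set0.
  apply/eqP/negPn/negP => /set0P.
  have pn : pr != nx.
    by apply/eqP => /(congr1 (@nat_of_ord j)); rewrite nxE prE => h; move: j4;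
      rewrite -(prednK j0) h.
  move/(nU _ _ pn); rewrite /cycle_rel pn /= /pr ord_predK => /orP[|].
    by rewrite (negbTE (neqS _)).
  move=> /eqP/(congr1 (@nat_of_ord j)); rewrite prE.
  have -> : ordS nx = (nx.+1 %% j)%N :> nat by [].
  rewrite nxE modn_small ?(leq_trans _ j4)// => h.
  by move: j4; rewrite -(prednK j0) h.
(* With [g i] taken in the overlap of [U (ord_pred i)] and [U i], both ends of side [i] lie in
   [U i], hence so does the side. *)
have [g hg] : exists g : 'I_j -> plane R, forall i,
  U (ord_pred i) (g i) /\ U i (g i).
  suff /choice[g hg] : forall i : 'I_j, exists x,
    U (ord_pred i) x /\ U i x by exists g.
  move=> i; by have [x [h1 h2]] := adj (ord_pred i); exists x;
    rewrite ord_predK in h2.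
have gS i : side g i `<=` U i.
  apply: convex_seg => //; first by have [] := hg i.
  by have [] := hg (ordS i); rewrite ordSK.
have gU : chain_curve g `<=` \bigcup_i U i by move=> x [i _ /gS]; exists i.
have [] := @separation _ (U pr `&` U i0) (U i0 `&` U nx).
- apply/convex_setP => x y t [h1 h2] [h3 h4] t01.
  by split; move: t01; [apply: (convex_setP _).1|apply: (convex_setP _).1].
- apply/convex_setP => x y t [h1 h2] [h3 h4] t01.
  by split; move: t01; [apply: (convex_setP _).1|apply: (convex_setP _).1].
- by apply: openI; exact: oU.
- by apply: openI; exact: oU.
- by exists (g i0); exact: hg.
- by exists (g nx); have := hg nx; rewrite /nx ordSK.
- by apply/seteqP; split=> // x [[h1 _] [_ h2]]; rewrite -pr_nx.
move=> d [f [d0 fpr fnx]].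
have fg0 : det d (g i0) < f by apply: fpr; exact: hg.
have fg1 : f < det d (g nx) by apply: fnx; have := hg nx;
  rewrite /nx ordSK => -[].
pose t := (f - det d (g i0)) / (det d (g nx) - det d (g i0)).
have gg : 0 < det d (g nx) - det d (g i0) by lra.
have t01 : 0 <= t <= 1.
  by rewrite /t ler_pdivlMr// ler_pdivrMr// mul0r mul1r; lra.
pose z := (1 - t) *: g i0 + t *: g nx.
have zside : side g i0 z by apply/segP; exists t.
have zf : det d z = f by rewrite det_conv /t; field; rewrite gt_eqF.
have zU : U i0 z by exact: gS.
have [r r0 [qU rU]] := chord_end (oU i0) (cU i0) (bU i0) d0 zU.
have dN0 : - d != 0 by rewrite oppr_eq0.
have [r' r'0 [q'U r'U]] := chord_end (oU i0) (cU i0) (bU i0) dN0 zU.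
set q := z + r *: d in qU; set q' := z + r' *: - d in q'U.
have inner (s : R) : - r' < s < r -> U i0 (z + s *: d).
  move=> /andP[s1 s2]; have [s0|s0] := leP 0 s; first by apply: rU; rewrite s0.
  by rewrite -[s *: d]opprK -scaleNr -scalerN; apply: r'U;
    rewrite oppr_ge0 ltW//=; lra.
have zs s : det d (z + s *: d) = f by rewrite -zf /det /= /GRing.scale /=; ring.
(* The point may be an end of the chord, outside [U i0]. Since [U i] is open, shrinking by [1 - m]
   towards [z] stays in [U i] and reaches the open chord, inside [U i0]. Then [i] is a neighbour of
   [i0], and the separating line excludes the level [f]. *)
have chord i x : i != i0 -> seg q' q x -> ~ U i x.
  move=> ii0 /segP[s [/andP[s0 s1] ->]] Ux.
  pose c := (1 - s) * (- r') + s * r.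
  have xE : (1 - s) *: q' + s *: q = z + c *: d.
    by apply: plane_eq; rewrite /q /q' /c /= /GRing.scale /=; ring.
  rewrite xE in Ux; have [e e0 he] := open_line (- c *: d) (oU i) Ux.
  pose m := Num.min (e / 2) (1 / 2).
  have m0 : 0 < m by rewrite lt_min; apply/andP; split; lra.
  have m1 : m <= 1 / 2 by rewrite ge_min lexx orbT.
  have me : m < e by rewrite gt_min; apply/orP; left; lra.
  have {}Ux : U i (z + ((1 - m) * c) *: d).
    have := he m; rewrite gtr0_norm// => /(_ me).
    by rewrite scalerA -addrA -scalerDl mulrN mulrBl mul1r.
  have Ux0 : U i0 (z + ((1 - m) * c) *: d).
    have c1 : 0 <= (1 - m) * (c + r').
      have -> : c + r' = s * (r + r') by rewrite /c; ring.
      by rewrite !mulr_ge0//; lra.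
    have c2 : 0 <= (1 - m) * (r - c).
      have -> : r - c = (1 - s) * (r + r') by rewrite /c; ring.
      by rewrite !mulr_ge0//; lra.
    have c3 : 0 < m * r' by rewrite mulr_gt0.
    have c4 : 0 < m * r by rewrite mulr_gt0.
    by apply: inner; apply/andP; split; lra.
  have : cycle_rel i i0 by apply/nU => //; exists (z + ((1 - m) * c) *: d).
  rewrite /cycle_rel ii0 /= => /orP[/eqP e1|/eqP e1].
    have : det d (z + ((1 - m) * c) *: d) < f.
      by apply: fpr; split=> //; rewrite /pr e1 ordSK.
    by rewrite zs ltxx.
  have : f < det d (z + ((1 - m) * c) *: d).
    by apply: fnx; split=> //; rewrite /nx -e1.
  by rewrite zs ltxx.
have qq x : (x = q \/ x = q') -> ~ (\bigcup_i U i) x.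
  move=> xq [i _ Ui]; have [ii|ii] := eqVneq i i0.
    by move: Ui; rewrite ii; case: xq => ->.
  by apply: (chord i x) => //; case: xq => ->; [exact: seg1|exact: seg0].
have : parity d g q = parity d g q'.
  apply: (parity_connected d0 cM).
  - apply/seteqP; split=> // x [Mx /gU gx].
    by have : closure M x by [exact: subset_closure]; rewrite hM.
  - by rewrite hM; apply: qq; left.
  - by rewrite hM; apply: qq; right.
  - by move=> /gU; apply: qq; left.
  - by move=> /gU; apply: qq; right.
(* Only side [i0], which passes through [z], changes its indicator between [q] and [q']; any other
   side that did would meet the chord inside its own [U i]. *)
suff : parity d g q (+) parity d g q' by move=> + e; rewrite e addbb.
rewrite /parity -big_split /= (bigD1 i0)//= big1 ?addbF.
  rewrite /q /q' scalerN; apply: crosses_through => //.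
    by rewrite zf (lt_gtF fg0) fg1.
  rewrite /z -/nx; rewrite /det /= /GRing.scale /=; ring.
move=> i ii0; apply/eqP; rewrite -[_ == false]negbK; apply/negP => h.
have qlev : det d q = det d q' by rewrite /q /q' scalerN -scaleNr !zs.
have [] := @crosses_neq_meet _ d q q' (g i) (g (ordS i)) qlev.
  by move: h; case: (crosses _ q _ _); case: (crosses _ q' _ _).
move=> x xq /gS Ux; apply: (chord i x) => //.
move/segP: xq => [s [/andP[s0 s1] ->]]; apply/segP; exists (1 - s); split.
  by apply/andP; split; lra.
by rewrite subKr addrC.
Qed.

End CyclicNerve.

(** * Strictly convex chains *)

Section ConvexChain.
Context {R : realType}.
Implicit Types (x y z d : plane R) (A : set (plane R)).

Variables (n : nat) (w : 'I_n -> plane R).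

Definition left_of (m : 'I_n) x : R := det (w (ordS m) - w m) (x - w m).

Definition inner_region : set (plane R) := [set x | forall m, 0 <= left_of m x].

Lemma left_ofS m : left_of m (w (ordS m)) = 0.
Proof. by rewrite /left_of /det mulrC subrr. Qed.

Lemma left_of0 m : left_of m (w m) = 0.
Proof. by rewrite /left_of /det /= !subrr !mulr0 subrr. Qed.

Lemma left_of_conv m x y (t : R) :
  left_of m ((1 - t) *: x + t *: y) = (1 - t) * left_of m x + t * left_of m y.
Proof. by rewrite /left_of /det /= /GRing.scale /=; ring. Qed.

Lemma left_of_affine m : exists a b c : R, forall x, left_of m x =
  affine a b c x.
Proof.
exists (- (w (ordS m) - w m).2), (w (ordS m) - w m).1,
  (- det (w (ordS m) - w m) (w m)) => x.
by rewrite /left_of /det /affine /=; ring.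
Qed.

Lemma left_of_near m x : 0 < left_of m x -> \forall y \near x, 0 < left_of m y.
Proof.
have [a [b [c E]]] := left_of_affine m; rewrite E => /affine_gt0_near.
by apply: filterS => y; rewrite E.
Qed.

Lemma left_ofN_near m x : left_of m x < 0 -> \forall y \near x, left_of m y < 0.
Proof.
have [a [b [c E]]] := left_of_affine m.
have EN y : - left_of m y = affine (- a) (- b) (- c) y by rewrite E /affine;
  ring.
rewrite -oppr_gt0 EN => /affine_gt0_near.
by apply: filterS => y; rewrite -EN oppr_gt0.
Qed.

Lemma inner_region_convex : convex_set inner_region.
Proof.
apply/convex_setP => x y t hx hy /andP[t0 t1] m; rewrite left_of_conv.
by rewrite addr_ge0// mulr_ge0// subr_ge0.
Qed.

Hypothesis n3 : (3 <= n)%N.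
Hypothesis wP : forall m p : 'I_n, p != m -> p != ordS m -> 0 < left_of m (w p).

Lemma inner_region_vertex p : inner_region (w p).
Proof.
move=> m; have [->|pm] := eqVneq p m; first by rewrite left_of0.
have [->|pSm] := eqVneq p (ordS m); first by rewrite left_ofS.
by rewrite ltW// wP.
Qed.

Lemma chain_curve_inner : chain_curve w `<=` inner_region.
Proof.
move=> x [m _]; apply: convex_seg;
  [exact: inner_region_convex|exact: inner_region_vertex..].
Qed.

(** A repeated vertex would lie on the line of the side starting at its copy. If [q] follows [p],
    the side starting at [q] is used, whose other end is not [p] because [3 <= n]. *)
Lemma convex_chain_inj : injective w.
Proof.
move=> p q wpq; apply/eqP/negPn/negP => pq.
have [qS|qS] := eqVneq q (ordS p); last first.
  by have := wP (m := p) (p := q);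
    rewrite eq_sym pq qS -wpq left_of0 ltxx => /(_ isT isT).
have := wP (m := q) (p := p); rewrite pq wpq left_of0 ltxx => /(_ isT).
by rewrite qS eq_sym ordSS_neq// => /(_ isT).
Qed.

(** On the line of side [m], the adjacent sides give affine functions, each zero at one end and
    positive at the other; their signs bound the parameter [t] to the unit interval. *)
Lemma inner_region_face m x : inner_region x -> left_of m x = 0 -> side w m x.
Proof.
move=> Tx mx; apply/segP.
have e0 : w (ordS m) - w m != 0.
  rewrite subr_eq0; apply/eqP => /convex_chain_inj/eqP.
  by rewrite (negbTE (ordS_neq _ _))// ltnW.
set e := w (ordS m) - w m in e0 mx; have ee := dot_gt0 e0.
pose t := dot e (x - w m) / dot e e.
have xE : x = (1 - t) *: w m + t *: w (ordS m).
  apply: (@det_inj _ e (- e.2, e.1)).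
  - by rewrite {1}/det /= mulrN opprK; move/gt_eqF: ee => /negbT.
  - transitivity (det e (w m)); first by apply/eqP;
    rewrite -subr_eq0 -mx /left_of -/e; apply/eqP; rewrite /det /=; ring.
    by rewrite /e /det /= /GRing.scale /=; ring.
  - have dE y : det (- e.2, e.1) y = - dot e y by rewrite /det /dot /=; ring.
    rewrite !dE; congr (- _); apply/eqP; rewrite -subr_eq0; apply/eqP.
    transitivity (dot e (x - w m) - t * dot e e).
      by rewrite /e /dot /= /GRing.scale /=; ring.
    by rewrite /t divfK ?gt_eqF// subrr.
exists t; split=> //; apply/andP; split.
  have := Tx (ord_pred m); rewrite xE left_of_conv.
  have {1}-> : w m = w (ordS (ord_pred m)) by rewrite ord_predK.
  rewrite left_ofS mulr0 add0r pmulr_lge0//; apply: wP.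
    by apply/eqP => h; have := ordSS_neq (ord_pred m) n3;
      rewrite ord_predK h eqxx.
  by rewrite ord_predK ordS_neq// ltnW.
have := Tx (ordS m); rewrite xE left_of_conv left_of0 mulr0 addr0 pmulr_lge0
  ?subr_ge0//.
by apply: wP; rewrite eq_sym ?ordS_neq ?ordSS_neq// ltnW.
Qed.

(** On side [i], [left_of j] is a convex combination of nonnegative values. If it vanished strictly
    between the ends, both ends would be on the line of side [j], which strict convexity forbids. *)
Lemma convex_chain_meet i j x : i != j -> side w i x -> side w j x ->
  x = w i \/ x = w (ordS i).
Proof.
move=> ij /segP[t [/andP[t0 t1] ->]] xj.
have : left_of j ((1 - t) *: w i + t *: w (ordS i)) = 0.
  move/segP: xj => [s [_ ->]].
  by rewrite left_of_conv left_of0 left_ofS !mulr0 addr0.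
have t1' : 0 <= 1 - t by rewrite subr_ge0.
rewrite left_of_conv => /eqP; rewrite paddr_eq0;
  [|exact/mulr_ge0/inner_region_vertex..].
rewrite !mulf_eq0 subr_eq0.
have [<-|tn1] := eqVneq 1 t; first by right;
  rewrite subrr scale0r add0r scale1r.
have [->|t0'] := eqVneq t 0; first by left; rewrite subr0 scale0r addr0 scale1r.
rewrite /= => /andP[/eqP h1 /eqP h2]; exfalso.
have iS : i = ordS j.
  by apply/eqP/negPn/negP => iS; have := wP ij iS; rewrite h1 ltxx.
have := wP (m := j) (p := ordS i);
  rewrite h2 ltxx iS ordSS_neq// ordS_neq ?(ltnW n3)//.
by move=> /(_ isT isT).
Qed.

Lemma convex_chain_simple : simple_chain w.
Proof.
split=> //.
- exact: convex_chain_inj.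
- move=> i j ij x [xi xj]; split; first exact: (convex_chain_meet ij).
  by apply: (@convex_chain_meet j i) => //; rewrite eq_sym.
- move=> i /segP[t [/andP[t0 t1] e]].
  have iS : i != ordS i by rewrite eq_sym ordS_neq// ltnW.
  have h1 := wP (m := i) (p := ordS (ordS i)).
  have {h1} h1 : 0 < left_of i (w (ordS (ordS i))).
    by apply: h1; [exact: ordSS_neq|rewrite ordS_neq// ltnW].
  have : left_of i (w (ordS i)) = t * left_of i (w (ordS (ordS i))).
    by rewrite {1}e left_of_conv left_of0 mulr0 add0r.
  rewrite left_ofS => /esym/eqP; rewrite mulf_eq0 (gt_eqF h1) orbF => /eqP t00.
  move: e; rewrite t00 subr0 scale1r scale0r addr0 => /convex_chain_inj/eqP.
  by rewrite eq_sym (negbTE iS).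
Qed.

Hypothesis bounded_inner : bounded_set inner_region.

(** Off the curve, [inner_region] agrees with the open set [P] of points strictly left of every
    side. So [P] is relatively clopen and contains the component of each of its points. *)
Lemma convex_chain_region : chain_region w = inner_region.
Proof.
apply/seteqP; split=> x; last first.
  move=> Tx; have [Cx|nCx] := pselect (chain_curve w x);
    [by left|right; split=> //].
  set K := connected_component _ _.
  have KP : K `<=` inner_region -> bounded_set K.
    move=> KT; have [r hr] := (bounded_planeP _).1 bounded_inner.
    by apply/bounded_planeP; exists r => y /KT/hr.
  apply: KP; pose P := [set y | forall m, 0 < left_of m y].
  have TP y : ~ chain_curve w y -> inner_region y -> P y.
    move=> nCy Ty m; rewrite lt_neqAle Ty andbT eq_sym; apply/eqP => h.
    by apply: nCy; exists m => //; exact: inner_region_face.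
  have -> : K = K `&` P; last by move=> y [_ Py] m; exact/ltW.
  have cK : connected K by exact: component_connected.
  apply/esym; apply: cK.
  - by exists x; split; [exact: connected_component_refl|exact: TP].
  - exists P => //; rewrite openE => y Py.
    have := @filter_forall _ _ (fun m y => 0 < left_of m y) (nbhs y)
      (nbhs_filter y).
    by apply=> m; exact: left_of_near.
  - exists inner_region.
      rewrite -[inner_region]setCK; apply: open_closedC; rewrite openE => y nTy.
      have [m hm] : exists m, left_of m y < 0.
        apply: contrapT => h; apply: nTy => m; rewrite leNgt; apply/negP => h'.
        by apply: h; exists m.
      have := left_ofN_near hm; apply: filterS => z hz /(_ m).
      by rewrite leNgt hz.
    apply/seteqP; split=> y [Ky h]; split=> //; first by move=> m; exact/ltW.
    by apply: TP => //; exact: (connected_component_sub Ky).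
move=> [Cx|[nCx bK]]; first exact: chain_curve_inner.
move=> m; rewrite leNgt; apply/negP => hm.
have [a [b [c E]]] := left_of_affine m.
have EN y : (left_of m y < 0) = (0 < affine (- a) (- b) (- c) y).
  by rewrite -oppr_gt0 E /affine; congr (_ < _); ring.
(* The open half-plane beyond side [m] is connected and misses the curve, so it lies in the
   component of [x]; a ray along the outward normal then contradicts boundedness. *)
have HK : [set y | left_of m y < 0] `<=` connected_component
  (~` chain_curve w) x.
  apply: connected_component_max => //.
    by move=> y /= hy /chain_curve_inner/(_ m); rewrite leNgt hy.
  have -> : [set y | left_of m y < 0] =
    [set y | 0 < affine (- a) (- b) (- c) y].
    by apply/seteqP; split=> y /=; rewrite EN.
  exact/convex_connected/halfplane_convex.
set e := w (ordS m) - w m.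
have e0 : e != 0.
  rewrite subr_eq0; apply/eqP => /convex_chain_inj/eqP.
  by rewrite (negbTE (ordS_neq _ _))// ltnW.
have u0 : ((e.2, - e.1) : plane R) != 0.
  apply: contra e0 => /eqP[h1 h2]; apply/eqP; apply: plane_eq => //=.
  by apply/eqP; rewrite -oppr_eq0; apply/eqP.
have [s hs] := bounded_ray x bK u0.
have Hs (r : R) : 0 <= r -> left_of m (x + r *: ((e.2, - e.1) : plane R)) < 0.
  move=> r0; have -> : left_of m (x + r *: ((e.2, - e.1) : plane R)) =
    left_of m x - r * dot e e.
    by rewrite /left_of -/e /det /dot /= /GRing.scale /=; ring.
  have := mulr_ge0 r0 (ltW (dot_gt0 e0)); lra.
have := hs (`|s| + 1) (HK _ (Hs _ (addr_ge0 (normr_ge0 s) ler01))).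
by rewrite leNgt ltr_pwDr// ler_norm.
Qed.

End ConvexChain.

(** * Half-planes with allowed directions *)

Section Directions.
Context {R : realType}.
Variable k : nat.
Implicit Types (x y z : plane R) (i j r s : nat).

Definition ang i : R := i%:R * pi / k%:R.
(** Indices have period [k + k], not [k]: [dirv (i + k)] is opposite to [dirv i], so that both
    half-planes of each allowed direction get an index. *)
Definition dirv i : plane R := (cos (ang i), sin (ang i)).

Hypothesis k2 : (2 <= k)%N.

Lemma k_gt0 : 0 < k%:R :> R. Proof. by rewrite ltr0n ltnW. Qed.

Lemma ang0 : ang 0 = 0. Proof. by rewrite /ang mul0r mul0r. Qed.

Lemma angD i j : ang (i + j) = ang i + ang j.
Proof. by rewrite /ang natrD !mulrDl. Qed.

Lemma angk : ang k = pi.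
Proof. by rewrite /ang mulrAC mulfV ?mul1r// gt_eqF ?k_gt0. Qed.

Lemma sin_ang_gt0 s : (0 < s < k)%N -> 0 < sin (ang s).
Proof.
move=> /andP[s0 sk]; apply: sin_gt0_pi; rewrite /ang; apply/andP; split.
  by rewrite divr_gt0 ?mulr_gt0 ?ltr0n ?pi_gt0// ltnW.
by rewrite ltr_pdivrMr ?k_gt0// mulrC ltr_pM2l ?pi_gt0// ltr_nat.
Qed.

Lemma sin_angDk s : sin (ang (s + k)) = - sin (ang s).
Proof. by rewrite angD angk sinD cospi sinpi mulr0 addr0 mulrN1. Qed.

Lemma cos_angDk s : cos (ang (s + k)) = - cos (ang s).
Proof. by rewrite angD angk cosD cospi sinpi mulr0 subr0 mulrN1. Qed.

Lemma sin_ang_lt0 s : (k < s < k + k)%N -> sin (ang s) < 0.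
Proof.
move=> /andP[s0 sk]; rewrite -(subnK (ltnW s0)) sin_angDk oppr_lt0.
by apply: sin_ang_gt0; rewrite subn_gt0 s0 ltn_subLR// ltnW.
Qed.

Lemma sin_ang1 : 0 < sin (ang 1). Proof. exact: sin_ang_gt0. Qed.

Lemma cos_ang1 : 0 <= cos (ang 1).
Proof.
apply: cos_ge0_pihalf; rewrite /ang mul1r; apply/andP; split.
  apply: (@le_trans _ _ 0); first by rewrite oppr_le0 divr_ge0 ?pi_ge0.
  by rewrite divr_ge0 ?pi_ge0.
by rewrite ler_pM2l ?pi_gt0// lef_pV2 ?posrE ?k_gt0// ler_nat.
Qed.

Lemma dirvDk i : dirv (i + k) = - dirv i.
Proof. by rewrite /dirv sin_angDk cos_angDk. Qed.

Lemma dirvD2k i : dirv (i + (k + k)) = dirv i.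
Proof. by rewrite addnA !dirvDk opprK. Qed.

Lemma det_dirv i s : det (dirv i) (dirv (i + s)) = sin (ang s).
Proof.
rewrite /det /= angD sinD cosD; have := cos2Dsin2 (ang i); set a :=
  cos (ang i); set b := sin (ang i) => e.
rewrite -[RHS]mul1r -e; ring.
Qed.

Lemma det_dirvS i : det (dirv i) (dirv i.+1) = sin (ang 1).
Proof. by rewrite -(det_dirv i 1) addn1. Qed.

(** Sum-to-product formula. It is the source of the formula for [len] and of the tightness
    inequality for support functions. *)
Lemma det_dirvSS x i :
  det x (dirv i) + det x (dirv i.+2) = 2 * cos (ang 1) * det x (dirv i.+1).
Proof.
have -> : i.+2 = (i + 1 + 1)%N by rewrite !addn1.
have -> : i.+1 = (i + 1)%N by rewrite addn1.
rewrite /det /dirv /= !(angD, sinD, cosD).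
have := cos2Dsin2 (ang 1); set a := cos (ang 1); set b := sin (ang 1) => e.
set u := cos (ang i); set v := sin (ang i).
apply/eqP; rewrite -subr_eq0; apply/eqP.
transitivity ((1 - (a ^+ 2 + b ^+ 2)) * ((x.1 : R) * v - (x.2 : R) * u));
  first by ring.
by rewrite e subrr mul0r.
Qed.

(** For positive [r] and [s] with [r + s < k], the middle direction is a positive combination of the
    outer two, so at a common vertex its constraint follows from theirs. *)
Lemma sin_dirv x i r s :
  sin (ang (r + s)) * det x (dirv (i + r)) =
  sin (ang s) * det x (dirv i) + sin (ang r) * det x (dirv (i + (r + s))).
Proof.
rewrite /det /dirv /= !(angD, sinD, cosD).
have := cos2Dsin2 (ang r); set a := cos (ang r); set b := sin (ang r) => e.
set u := cos (ang i); set v := sin (ang i); set g := cos (ang s); set h :=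
  sin (ang s).
rewrite -[h * _]mul1r -e; ring.
Qed.

Variable c : nat -> R.

Definition half_planes : set (plane R) :=
  [set x | forall i, det x (dirv i) <= c i].

(* [vertex i] is the common point of the lines bounding the half-planes [i] and
   [i.+1]; hence the edge from [vertex i] to [vertex i.+1], of length [len i],
   lies on the line [i.+1]. *)
Definition vertex i : plane R :=
  (sin (ang 1))^-1 *: (c i.+1 *: dirv i - c i *: dirv i.+1).
Definition len i : R :=
  (c i + c i.+2 - 2 * cos (ang 1) * c i.+1) / sin (ang 1).

Lemma vertex_line i : det (vertex i) (dirv i) = c i.
Proof.
have -> : det (vertex i) (dirv i) =
  (sin (ang 1))^-1 * (c i * det (dirv i) (dirv i.+1)).
  by rewrite /det /= /GRing.scale /=; ring.
by rewrite det_dirvS mulrCA mulVf ?mulr1// gt_eqF// sin_ang1.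
Qed.

Lemma vertex_lineS i : det (vertex i) (dirv i.+1) = c i.+1.
Proof.
have -> : det (vertex i) (dirv i.+1) =
  (sin (ang 1))^-1 * (c i.+1 * det (dirv i) (dirv i.+1)).
  by rewrite /det /= /GRing.scale /=; ring.
by rewrite det_dirvS mulrCA mulVf ?mulr1// gt_eqF// sin_ang1.
Qed.

Lemma vertexS i : vertex i.+1 = vertex i + len i *: dirv i.+1.
Proof.
have s0 : sin (ang 1) != 0 by rewrite gt_eqF// sin_ang1.
apply: (@det_inj _ (dirv i.+1) (dirv i.+2)).
- by rewrite det_dirvS.
- have E x : det (dirv i.+1) x = - det x (dirv i.+1) by rewrite /det; ring.
  rewrite !E vertex_line.
  have -> : det (vertex i + len i *: dirv i.+1) (dirv i.+1) =
    det (vertex i) (dirv i.+1).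
    by rewrite /det /= /GRing.scale /=; ring.
  by rewrite vertex_lineS.
- have E x : det (dirv i.+2) x = - det x (dirv i.+2) by rewrite /det; ring.
  rewrite !E vertex_lineS; congr (- _).
  have -> : det (vertex i + len i *: dirv i.+1) (dirv i.+2) =
      det (vertex i) (dirv i.+2) + len i * det (dirv i.+1) (dirv i.+2).
    by rewrite /det /= /GRing.scale /=; ring.
  have := det_dirvSS (vertex i) i; rewrite vertex_line vertex_lineS => e.
  have -> : det (vertex i) (dirv i.+2) = 2 * cos (ang 1) * c i.+1 -
    c i by rewrite -e; ring.
  by rewrite det_dirvS /len; field.
Qed.

Hypothesis cper : forall i, c (i + (k + k)) = c i.
(** Equivalent to [0 <= len i]: line [i.+1] does not pass beyond the common point of lines [i] and
    [i.+2]. For [k = 2] these are parallel, and the condition keeps them in the right order. *)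
Hypothesis ctight : forall i, 2 * cos (ang 1) * c i.+1 <= c i + c i.+2.

Lemma len_ge0 i : 0 <= len i.
Proof. by rewrite divr_ge0 ?(ltW sin_ang1)// subr_ge0. Qed.

Lemma len_per i : len (i + (k + k)) = len i.
Proof. by rewrite /len -!addSn !cper. Qed.

Lemma vertex_per i : vertex (i + (k + k)) = vertex i.
Proof. by rewrite /vertex -!addSn !cper !dirvD2k. Qed.

Lemma vertex_const a b : (a <= b)%N ->
  (forall e, (a <= e < b)%N -> len e = 0) ->
  vertex a = vertex b.
Proof.
move=> /subnKC <-; elim: (b - a)%N => [|n IH] h; first by rewrite addn0.
rewrite addnS vertexS h ?leq_addr ?addnS//= scale0r addr0;
  apply: IH => e /andP[ae eb].
by rewrite h// ae addnS ltnW.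
Qed.

(** Signed distance from line [i] to the vertex reached after [r] edges. It is zero at [r = 0],
    rises while the edges have turned by less than pi, then falls back to zero at
    [r = (k + k).-1]. *)
Definition slack i r : R := c i - det (vertex (i + r)) (dirv i).

Lemma slack0 i : slack i 0 = 0.
Proof. by rewrite /slack addn0 vertex_line subrr. Qed.

Lemma slackS i r : slack i r.+1 = slack i r + len (i + r) * sin (ang r.+1).
Proof.
rewrite /slack addnS vertexS; set v := vertex _; rewrite -addnS -(det_dirv i).
by rewrite /det /= /GRing.scale /=; ring.
Qed.

Lemma slack_last i : slack i (k + k).-1 = 0.
Proof.
have kk : (0 < k + k)%N by rewrite addn_gt0 ltnW.
rewrite /slack; have <- : dirv (i + (k + k).-1).+1 =
  dirv i by rewrite -addnS prednK// dirvD2k.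
by rewrite vertex_lineS -addnS prednK// cper subrr.
Qed.

Lemma sin_ang_ge0 s : (s <= k)%N -> 0 <= sin (ang s).
Proof.
rewrite leq_eqVlt => /orP[/eqP ->|sk]; first by rewrite angk sinpi.
by case: s sk => [|s] sk; [rewrite ang0 sin0|rewrite ltW// sin_ang_gt0].
Qed.

Lemma sin_ang_le0 s : (k <= s < k + k)%N -> sin (ang s) <= 0.
Proof.
rewrite leq_eqVlt => /andP[/orP[/eqP <- _|ks sk]]; first by rewrite angk sinpi.
by rewrite ltW// sin_ang_lt0// ks.
Qed.

Lemma slack_incr i r r' : (r <= r' <= k)%N -> slack i r <= slack i r'.
Proof.
move=> /andP[/subnKC <-]; elim: (r' - r)%N => [|n IH]; first by rewrite addn0.
rewrite addnS => h; rewrite slackS; apply: (le_trans (IH (ltnW h))).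
by rewrite lerDl mulr_ge0 ?len_ge0// sin_ang_ge0.
Qed.

Lemma slack_decr i r r' : (k.-1 <= r <= r')%N -> (r' < k + k)%N ->
  slack i r' <= slack i r.
Proof.
move=> /andP[kr /subnKC <-]; elim: (r' - r)%N => [|n IH];
  first by rewrite addn0.
rewrite addnS => h; rewrite slackS; apply: le_trans (IH (ltnW h)).
rewrite gerDl mulr_ge0_le0 ?len_ge0// sin_ang_le0// h andbT.
by move: kr; lia.
Qed.

(** For [r < k] an earlier edge of positive length gives a strict rise from zero; otherwise a later
    one gives a strict fall still to come. *)
Lemma slack_gt0 i r : (r < k + k)%N ->
  (exists2 s, (s < r)%N & 0 < len (i + s)) ->
  (exists2 s, (r <= s < (k + k).-1)%N & 0 < len (i + s)) -> 0 < slack i r.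
Proof.
move=> rk [s sr ls] [s' /andP[rs' s'k] ls'].
have [rk'|kr] := ltnP r k.
  apply: (@lt_le_trans _ _ (slack i s.+1)); last by apply: slack_incr;
    rewrite sr ltnW.
  rewrite slackS ltr_wpDl//; first by rewrite -(slack0 i) slack_incr//=; lia.
  by rewrite mulr_gt0// sin_ang_gt0//; lia.
apply: (@lt_le_trans _ _ (slack i s')); last by apply: slack_decr; lia.
have := @slack_decr i s'.+1 (k + k).-1; rewrite slack_last slackS => h.
have {}h : 0 <= slack i s' + len (i + s') * sin (ang s'.+1) by apply: h; lia.
have : len (i + s') * sin (ang s'.+1) < 0 by rewrite pmulr_rlt0//
  sin_ang_lt0//; lia.
lra.
Qed.

(** If these edges all had length zero, [vertex i] would lie on both lines [i] and [i + k], which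
    would coincide; but [y] is strictly between these parallel lines. *)
Lemma slack_window i y : (forall j, det y (dirv j) < c j) ->
  exists2 s, (s < k.-1)%N & 0 < len (i + s).
Proof.
move=> hy; apply: contrapT => h.
have z s : (s < k.-1)%N -> len (i + s) = 0.
  move=> sk; apply/eqP; rewrite eq_le len_ge0 andbT leNgt; apply/negP => l0.
  by apply: h; exists s.
have vv : vertex i = vertex (i + k.-1).
  apply: vertex_const; first exact: leq_addr.
  by move=> e /andP[ie ek]; rewrite -(subnKC ie) z// ltn_subLR.
have := hy i; have := hy (i + k); rewrite dirvDk.
have -> : det y (- dirv i) = - det y (dirv i) by rewrite /det /=; ring.
have <- : det (vertex (i + k.-1)) (dirv (i + k.-1).+1) = c (i + k).
  by rewrite vertex_lineS -addnS prednK// ltnW.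
rewrite -addnS prednK ?(ltnW k2)// dirvDk -vv -(vertex_line i).
have -> : det (vertex i) (- dirv i) =
  - det (vertex i) (dirv i) by rewrite /det /=; ring.
lra.
Qed.

End Directions.

(** * Tight half-planes bound a convex lizard *)

Section HalfPlanesLizard.
Context {R : realType}.
Variables (k : nat) (c : nat -> R) (y : plane R).
Implicit Types (x z : plane R).
Hypothesis k2 : (2 <= k)%N.
Hypothesis cper : forall i, c (i + (k + k)) = c i.
Hypothesis ctight : forall i, 2 * cos (ang k 1) * c i.+1 <= c i + c i.+2.
Hypothesis cy : forall i, det y (dirv k i) < c i.
Hypothesis cbounded : bounded_set (half_planes k c).

Local Notation len := (len k c).
Local Notation vertex := (vertex k c).

(* The edges of positive length, in cyclic order; [long_edges] indexes the
   sides of the polygon, the other constraints being tight at a vertex only. *)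
Definition long_edges : seq nat := [seq e <- iota 0 (k + k) | 0 < len e].

Lemma mem_long_edges e : (e \in long_edges) = (e < k + k)%N && (0 < len e).
Proof. by rewrite mem_filter mem_iota /= add0n andbC. Qed.

Local Notation n := (size long_edges).
Definition edge (m : nat) : nat := nth 0%N long_edges m.

Lemma edge_mem m : (m < n)%N -> edge m \in long_edges.
Proof. exact: mem_nth. Qed.

Lemma edge_lt m : (m < n)%N -> (edge m < k + k)%N.
Proof. by move=> /edge_mem; rewrite mem_long_edges => /andP[]. Qed.

Lemma len_edge m : (m < n)%N -> 0 < len (edge m).
Proof. by move=> /edge_mem; rewrite mem_long_edges => /andP[]. Qed.

Lemma edge_mono m p : (m < p < n)%N -> (edge m < edge p)%N.
Proof.
move=> /andP[mp pn]; apply: (sorted_ltn_nth ltn_trans) => //.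
- exact/sorted_filter/iota_ltn_sorted/ltn_trans.
- by rewrite inE (ltn_trans mp).
Qed.

Lemma edge_surj e : (e < k + k)%N -> 0 < len e -> exists2 m, (m < n)%N & e =
  edge m.
Proof.
move=> ek le; have el : e \in long_edges by rewrite mem_long_edges ek.
by exists (index e long_edges); rewrite ?index_mem// /edge nth_index.
Qed.

Lemma len0P e : ~ 0 < len e -> len e = 0.
Proof. by move=> /negP; rewrite -leNgt => h; apply/eqP;
  rewrite eq_le h len_ge0. Qed.

Lemma edge_gap m e : (m.+1 < n)%N -> (edge m < e < edge m.+1)%N -> len e = 0.
Proof.
move=> mn /andP[h1 h2]; apply: len0P => le.
have [p pn ep] := edge_surj (ltn_trans h2 (edge_lt mn)) le; move: h1 h2;
  rewrite ep => h1 h2.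
have [pm|mp] := leqP p m.
  move: pm h1; rewrite leq_eqVlt => /orP[/eqP ->|pm]; first by rewrite ltnn.
  by rewrite ltnNge ltnW// edge_mono// pm ltnW.
move: mp h2; rewrite leq_eqVlt => /orP[/eqP <-|mp]; first by rewrite ltnn.
by rewrite ltnNge ltnW// edge_mono// mp.
Qed.

Lemma edge_gap_last e : (0 < n)%N -> (edge n.-1 < e < edge 0 + (k + k))%N ->
  len e = 0.
Proof.
move=> n0 /andP[h1 h2]; apply: len0P => le.
have [ek|ke] := ltnP e (k + k).
  have [p pn ep] := edge_surj ek le; move: h1; rewrite ep.
  have [->|pn1] := eqVneq p n.-1; first by rewrite ltnn.
  by rewrite ltnNge ltnW// edge_mono//; lia.
rewrite -(subnK ke) len_per// in le.
have e0k := edge_lt n0.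
have [p pn ep] := edge_surj (e := (e - (k + k))%N) ltac:(lia) le.
have [p0|p0] := posnP p; first by move: ep; rewrite p0; lia.
by have := @edge_mono 0 p; rewrite p0 pn => /(_ isT); lia.
Qed.

(** Three windows of [k.-1] indices are searched, each starting just after the previous find. The
    last find exceeds the first by at most [2 * (k - 1)], so the three differ modulo [k + k]. *)
Lemma long_edges_ge3 : (3 <= n)%N.
Proof.
have kk : (0 < k + k)%N by rewrite addn_gt0 ltnW.
have [a ak la] := slack_window k2 ctight 0 cy.
have [b bk lb] := slack_window k2 ctight (0 + a).+1 cy.
have [d dk ld] := slack_window k2 ctight ((0 + a).+1 + b).+1 cy.
move: la lb ld; rewrite add0n; move bE: (a.+1 + b)%N => b';
  move dE: (b'.+1 + d)%N => d' la lb ld.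
pose red e := if (e < k + k)%N then e else (e - (k + k))%N.
have lred e : 0 < len e -> 0 < len (red e).
  by rewrite /red; case: ltnP => // ke; rewrite -{1}(subnK ke) len_per.
have redlt e : (e < (k + k) + (k + k))%N -> (red e < k + k)%N.
  by rewrite /red; case: (ltnP e (k + k)) => ? ?; lia.
suff : (size [:: red a; red b'; red d'] <= n)%N by [].
apply: uniq_leq_size.
  rewrite /= !inE /red; apply/and3P; split=> //.
    by case: ltnP => ?; case: ltnP => ?; case: ltnP => ?; lia.
  by case: ltnP => ?; case: ltnP => ?; lia.
move=> e; rewrite !inE mem_long_edges => /or3P[] /eqP ->;
  rewrite lred// andbT redlt//; lia.
Qed.

Let n0 : (0 < n)%N. Proof. exact: leq_trans long_edges_ge3. Qed.

Definition corner (m : 'I_n) : plane R := vertex (edge m).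

Lemma cornerS m : corner (ordS m) =
  corner m + len (edge m) *: dirv k (edge m).+1.
Proof.
rewrite /corner -vertexS//; have [[h ->]|[h ->]] := ordSE m.
  apply/esym/vertex_const => //; first by apply: edge_mono; rewrite leqnn.
  by move=> e; exact: edge_gap.
rewrite -[vertex (edge 0)](vertex_per k2 cper); apply/esym/vertex_const => //.
  by rewrite (leq_trans (edge_lt (ltn_ord m)))// leq_addl.
move=> e he; apply: edge_gap_last => //; by rewrite -h.
Qed.

Lemma left_of_corner m x : left_of corner m x =
  len (edge m) * (c (edge m).+1 - det x (dirv k (edge m).+1)).
Proof.
rewrite /left_of cornerS -(vertex_lineS k2 c (edge m)) -/(corner m).
by rewrite /det /= /GRing.scale /=; ring.
Qed.

(** [slack_gt0] for the line of side [m]: the long edge after [m] comes before corner [p], since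
    [p != ordS m], and the edge leaving [p] comes after it. *)
Lemma corner_convex (m p : 'I_n) : p != m -> p != ordS m ->
  0 < left_of corner m (corner p).
Proof.
move=> pm pSm; rewrite left_of_corner mulr_gt0 ?len_edge//.
have eE i r : c i - det (vertex (i + r)) (dirv k i) = slack k c i r by [].
have pm' : p != m :> nat by [].
have pSm' : p != ordS m :> nat by [].
have pk := edge_lt (ltn_ord p); have lp := len_edge (ltn_ord p).
have mk := edge_lt (ltn_ord m).
have [mp|pm''] := ltnP m p.
  have mpe : (edge m < edge p)%N by rewrite edge_mono// mp /=.
  have [[h Sm]|[h _]] := ordSE m; last by have := ltn_ord p; lia.
  have h1 : (m.+1 < p)%N by move: pSm'; rewrite Sm; lia.
  have h2 : (edge m.+1 < edge p)%N by rewrite edge_mono// h1 /=.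
  have h3 : (edge m < edge m.+1)%N by rewrite edge_mono// ltnSn.
  rewrite /corner -(subnKC mpe) eE; apply: slack_gt0 => //; first by lia.
    exists (edge m.+1 - (edge m).+1)%N; first by lia.
    by rewrite subnKC// len_edge.
  exists (edge p - (edge m).+1)%N; first by lia.
  by rewrite subnKC.
have {pm''}pm'' : (p < m)%N by lia.
have pme : (edge p < edge m)%N by rewrite edge_mono// pm'' /=.
have hk : ((edge m).+1 <= edge p + (k + k))%N by lia.
rewrite /corner -(vertex_per k2 cper) -(subnKC hk) eE; apply: slack_gt0 => //;
  first by lia.
  have [[h Sm]|[h Sm]] := ordSE m.
    have h3 : (edge m < edge m.+1)%N by rewrite edge_mono// ltnSn.
    have h4 := edge_lt h.
    exists (edge m.+1 - (edge m).+1)%N; first by lia.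
    by rewrite subnKC// len_edge.
  have p0 : (0 < p)%N by move: pSm'; rewrite Sm; lia.
  have h0 : (edge 0 < edge p)%N by rewrite edge_mono// p0 /=.
  exists (edge 0 + (k + k) - (edge m).+1)%N; first by lia.
  by rewrite subnKC ?len_per ?len_edge//; lia.
exists (edge p + (k + k) - (edge m).+1)%N; first by lia.
by rewrite subnKC// len_per.
Qed.

(** The constraint of an edge [e] of length zero must follow from the long ones. Its line passes
    through the vertex shared by the nearest long edges [b < e < a], and [a - b < k], so [sin_dirv]
    applies. *)
Lemma inner_region_corner : inner_region corner = half_planes k c.
Proof.
apply/seteqP; split=> x hx; last first.
  by move=> m; rewrite left_of_corner mulr_ge0 ?(ltW (len_edge _))// subr_ge0.
have long e : 0 < len e -> det x (dirv k e.+1) <= c e.+1.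
  move=> le; have kk : (0 < k + k)%N by rewrite addn_gt0 ltnW.
  have red i : (forall e', (e' < k + k)%N -> 0 < len e' ->
    det x (dirv k e'.+1) <= c e'.+1) ->
      0 < len i -> det x (dirv k i.+1) <= c i.+1.
    move=> h; elim/ltn_ind: i => i IH li; have [ik|ki] := ltnP i (k + k);
      first exact: h.
    have := IH (i - (k + k))%N ltac:(lia).
    have -> : (i.+1 = (i - (k + k)).+1 + (k + k))%N by lia.
    rewrite cper dirvD2k//; apply.
    by move: li; rewrite -{1}(subnK ki) len_per.
  apply: red le => e' ek le; have [m mn em] := edge_surj ek le.
  have := hx (Ordinal mn); rewrite left_of_corner /= -em.
  by rewrite pmulr_rge0// subr_ge0.
move=> i; rewrite -(dirvD2k k2) -cper.
(* Shifting by one period leaves room below [e] for a long edge. *)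
set e := (i + (k + k).-1)%N; have -> : (i + (k + k) = e.+1)%N by rewrite /e;
  lia.
have [/long//|/negP/len0P le] := boolP (0 < len e).
have exb : exists b, (b < e)%N && (0 < len b).
  have [s sk ls] := slack_window k2 ctight (i + k) cy.
  by exists (i + k + s)%N; rewrite ls andbT /e; lia.
have ubb b : (b < e)%N && (0 < len b) -> (b <= e)%N by move=> /andP[/ltnW].
have [b /andP[be lb] bmax] := ex_maxnP exb ubb.
have gap m : (b < m <= e)%N -> len m = 0.
  move=> /andP[bm me]; move: me; rewrite leq_eqVlt => /orP[/eqP -> //|me].
  by apply: len0P => lm; have := bmax m; rewrite me lm => /(_ isT);
    rewrite leqNgt bm.
have [s sk ls] := slack_window k2 ctight b.+1 cy.
have eb : (e < b.+1 + s)%N.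
  by rewrite ltnNge; apply/negP => h; move: ls; rewrite gap ?ltxx// h andbT;
    lia.
have exa : exists a, (e < a)%N && (0 < len a) by exists (b.+1 + s)%N;
  rewrite eb.
have [a /andP[ea la] amin] := ex_minnP exa.
have abk : (a < b + k)%N by have := amin (b.+1 + s)%N;
  rewrite eb ls => /(_ isT); lia.
have gap' m : (b < m < a)%N -> len m = 0.
  move=> /andP[bm ma]; have [me|em] := leqP m e; first by apply: gap;
    rewrite bm.
  by apply: len0P => lm; have := amin m; rewrite em lm => /(_ isT);
    rewrite leqNgt ma.
have vE m : (b < m <= a)%N -> vertex m = vertex b.+1.
  move=> /andP[bm ma]; apply/esym/vertex_const => // m' /andP[h1 h2].
  by apply: gap'; rewrite h1 (leq_trans h2).
have hb := long b lb; have ha := long a la.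
move: hb ha; rewrite -(vertex_line k2 c b.+1) -(vertex_lineS k2 c a)
  -(vertex_lineS k2 c e).
rewrite !vE ?leqnn ?andbT ?(ltn_trans be ea) ?be ?(ltnW ea)//=.
set v := vertex b.+1 => hb ha.
have det_sub j : det (v - x) (dirv k j) = det v (dirv k j) - det x (dirv k j).
  by rewrite /det /=; ring.
rewrite -subr_ge0 -det_sub; rewrite -subr_ge0 -det_sub in hb;
  rewrite -subr_ge0 -det_sub in ha.
have := sin_dirv k (v - x) b.+1 (e - b) (a - e).
have -> : (b.+1 + (e - b) = e.+1)%N by lia.
have -> : (b.+1 + (e - b + (a - e)) = a.+1)%N by lia.
move=> E; rewrite -(pmulr_rge0 _ (x := sin (ang k (e - b + (a - e))))).
  by rewrite E addr_ge0// mulr_ge0// ltW// sin_ang_gt0//; lia.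
by apply: sin_ang_gt0 => //; lia.
Qed.

Lemma half_planes_convex : convex_set (half_planes k c).
Proof. by rewrite -inner_region_corner; exact: inner_region_convex. Qed.

Lemma half_planes_lizard : convex_k_lizard k (half_planes k c).
Proof.
split; last exact: half_planes_convex.
have nn := long_edges_ge3; have ck := corner_convex.
exists n, corner; split.
- exact: convex_chain_simple.
- by rewrite convex_chain_region// inner_region_corner.
(* Sides are directed modulo 2 pi but allowed directions are modulo pi, so the index is reduced
   modulo [k] and the sign goes into the scalar. *)
- move=> m; set i := (edge m).+1;
  have ik : (i %% k < k)%N by rewrite ltn_mod ltnW.
  exists (ang k (i %% k)); last by exists (i %% k)%N.
  split.
    rewrite /ang divr_ge0 ?mulr_ge0 ?pi_ge0//= ltr_pdivrMr ?k_gt0// mulrC.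
    by rewrite ltr_pM2l ?pi_gt0// ltr_nat.
  have [s s0 ds] : exists2 s : R, s != 0 & dirv k i = s *: dirv k (i %% k).
    rewrite {1}(divn_eq i k); elim: (i %/ k)%N => [|q [s s0 IH]].
      by exists 1; rewrite ?oner_neq0// mul0n add0n scale1r.
    exists (- s); rewrite ?oppr_eq0// mulSn -addnA addnC dirvDk// IH.
    by rewrite scaleNr.
  exists (len (edge m) * s); first by rewrite mulf_neq0// gt_eqF// len_edge.
  by rewrite cornerS addrAC subrr add0r -/i ds scalerA.
Qed.

End HalfPlanesLizard.

(** * Hull of a convex lizard *)

Section LizardHull.
Context {R : realType}.
Implicit Types (x y z d : plane R) (S T L : set (plane R)).

Lemma chain_curve_compact n (v : 'I_n -> plane R) : compact (chain_curve v).
Proof.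
have -> : chain_curve v = \big[setU/set0]_(i <- enum 'I_n) side v i.
  rewrite -bigcup_seq; apply/seteqP; split=> x [i _ ix]; exists i => //=.
  by rewrite mem_enum.
by apply: bigsetU_compact => i _; exact: seg_compact.
Qed.

Lemma chain_curve_closed n (v : 'I_n -> plane R) : closed (chain_curve v).
Proof. by apply: compact_closed;
  [exact: norm_hausdorff|exact: chain_curve_compact]. Qed.

Lemma chain_curve_bounded n (v : 'I_n -> plane R) : bounded_set (chain_curve v).
Proof. by apply: compact_bounded; exact: chain_curve_compact. Qed.

Lemma lizard_closed k S : k_lizard k S -> closed S.
Proof.
move=> [n [v [_ -> _]]]; rewrite -[chain_region v]/(fill (chain_curve v)).
by apply: fill_closed; [exact: chain_curve_closed|exact: chain_curve_bounded].
Qed.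

Lemma lizard_bounded k S : k_lizard k S -> bounded_set S.
Proof.
move=> [n [v [_ -> _]]]; rewrite -[chain_region v]/(fill (chain_curve v)).
by apply: fill_bounded; exact: chain_curve_bounded.
Qed.

Lemma lizardC_connected k S : k_lizard k S -> connected (~` S).
Proof.
move=> [n [v [_ -> _]]]; rewrite -[chain_region v]/(fill (chain_curve v)).
by apply: fillC_connected; exact: chain_curve_bounded.
Qed.

Variable k : nat.
Hypothesis k2 : (2 <= k)%N.

Definition support S i : R := sup [set det x (dirv k i) | x in S].
Definition hull S : set (plane R) := half_planes k (support S).

Lemma support_has_sup S i : bounded_set S -> S !=set0 ->
  has_sup [set det x (dirv k i) | x in S].
Proof.
move=> /bounded_planeP[r hr] [x Sx]; split;
  first by exists (det x (dirv k i)); exists x.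
exists (r * `|(dirv k i).2 : R| + r * `|(dirv k i).1 : R|) =>
  _ [z /hr[h1 h2] <-].
rewrite /det (le_trans (ler_norm _))// (le_trans (ler_normB _ _))// !normrM.
by rewrite lerD// ler_wpM2r.
Qed.

Lemma support_ge S i x : bounded_set S -> S x ->
  det x (dirv k i) <= support S i.
Proof.
move=> bS Sx; apply: sup_upper_bound; last by exists x.
by apply: support_has_sup => //; exists x.
Qed.

Lemma support_le S i (r : R) : S !=set0 ->
  (forall x, S x -> det x (dirv k i) <= r) -> support S i <= r.
Proof.
move=> [x Sx] h; apply: sup_le_ub; first by exists (det x (dirv k i)); exists x.
by move=> _ [z Sz <-]; exact: h.
Qed.

Lemma support_gt S i (r : R) : S !=set0 -> r < support S i ->
  exists2 x, S x & r < det x (dirv k i).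
Proof.
move=> S0 rS; apply: contrapT => h; move: rS; rewrite ltNge => /negP; apply.
apply: support_le => // x Sx; rewrite leNgt; apply/negP => rx; apply: h;
  by exists x.
Qed.

Lemma sub_hull S : bounded_set S -> S `<=` hull S.
Proof. by move=> bS x Sx i; exact: support_ge. Qed.

Lemma support_per S i : support S (i + (k + k)) = support S i.
Proof. by rewrite /support dirvD2k. Qed.

Lemma support_tight S i : bounded_set S -> S !=set0 ->
  2 * cos (ang k 1) * support S i.+1 <= support S i + support S i.+2.
Proof.
move=> bS S0; have h x : S x ->
    2 * cos (ang k 1) * det x (dirv k i.+1) <= support S i + support S i.+2.
  by move=> Sx; rewrite -det_dirvSS lerD// support_ge.
(* The cosine vanishes for [k = 2], where one cannot divide by it. *)
have := @cos_ang1 R k k2; rewrite le_eqVlt => /orP[/eqP c0|c0].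
  by have [x /h] := S0; rewrite -c0 !mulr0 !mul0r.
have c20 : 0 < 2 * cos (ang k 1) :> R by rewrite mulr_gt0.
rewrite mulrC -ler_pdivlMr//; apply: support_le => // x Sx.
by rewrite ler_pdivlMr// mulrC; exact: h.
Qed.

Lemma hull_lizard S y : bounded_set S -> S !=set0 ->
  (forall i, det y (dirv k i) < support S i) -> bounded_set (hull S) ->
  convex_k_lizard k (hull S).
Proof.
move=> bS S0 hy bH; apply: (half_planes_lizard k2 (support_per S)) hy bH.
by move=> i; exact: support_tight.
Qed.

Lemma last_point S y x : closed S -> S y -> ~ S x ->
  exists t : R, [/\ 0 <= t < 1, S ((1 - t) *: y + t *: x) &
    forall s : R, t < s <= 1 -> ~ S ((1 - s) *: y + s *: x)].
Proof.
move=> cS Sy nSx; pose D := [set s : R |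
  0 <= s <= 1 /\ S ((1 - s) *: y + s *: x)].
have D0 : D 0 by split; rewrite ?lexx ?ler01// subr0 scale1r scale0r addr0.
have hD : has_sup D by split; [exists 0|exists 1 => s [/andP[_]]].
have t0 : 0 <= sup D by exact: sup_upper_bound.
have t1 : sup D <= 1 by apply: sup_le_ub; [exists 0|move=> s [/andP[_]]].
have St : S ((1 - sup D) *: y + sup D *: x).
  apply: contrapT => nS; have [e e0 he] :=
    open_line (x - y) (closed_openC cS) nS.
  have [s [s01 Ss] hs] := sup_adherent e0 hD.
  have sD : s <= sup D by apply: sup_upper_bound.
  apply: (he (s - sup D)); first by rewrite ltr_norml; apply/andP; split; lra.
  move: Ss; congr (S _); apply: plane_eq; rewrite /= /GRing.scale /=; ring.
exists (sup D); split=> //.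
- rewrite t0 lt_neqAle t1 andbT; apply/eqP => e1; apply: nSx; move: St.
  by rewrite e1 subrr scale0r add0r scale1r.
- move=> s /andP[ts s1] Ss; have : s <= sup D.
    by apply: sup_upper_bound => //; split=> //; rewrite s1 (le_trans t0)// ltW.
  by rewrite leNgt ts.
Qed.

Lemma det_eq0_collinear d x : d != 0 -> det x d = 0 -> exists m : R, x = m *: d.
Proof.
move=> d0 xd; have dd := dot_gt0 d0; exists (dot d x / dot d d).
apply: (@det_inj _ d (- d.2, d.1)).
- by rewrite {1}/det /= mulrN opprK; move/gt_eqF: dd => /negbT.
- transitivity (- det x d); first by rewrite /det; ring.
  by rewrite xd oppr0 /det /= /GRing.scale /=; ring.
- have dE y : det (- d.2, d.1) y = - dot d y by rewrite /det /dot /=; ring.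
  have dZ (r : R) : dot d (r *: d) =
    r * dot d d by rewrite /dot /= /GRing.scale /=; ring.
  by rewrite !dE dZ divfK ?gt_eqF.
Qed.

(** The product of the affine functions is a nonzero polynomial [p], which cannot vanish at all of
    [size p] distinct points of the unit interval. *)
Lemma affine_avoid n (a b : 'I_n -> R) : (forall i, (a i != 0) || (b i != 0)) ->
  exists s : R, 0 <= s <= 1 /\ forall i, (1 - s) * a i + s * b i != 0.
Proof.
move=> ab; pose p : {poly R} := \prod_i ((a i)%:P + (b i - a i) *: 'X).
have fE i s : ((a i)%:P + (b i - a i) *: 'X).[s] = (1 - s) * a i + s * b i.
  by rewrite !hornerE; ring.
have pE s : p.[s] = \prod_i ((1 - s) * a i + s * b i).
  by rewrite horner_prod; apply: eq_bigr => i _; exact: fE.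
have p0 : p != 0.
  apply/prodf_neq0 => i _; apply/eqP => h.
  have h0 : a i = 0 by have := fE i 0; rewrite h horner0; lra.
  have h1 : b i = 0 by have := fE i 1; rewrite h horner0; lra.
  by have := ab i; rewrite h0 h1 eqxx.
have N0 : 0 < (size p)%:R :> R by rewrite ltr0n size_poly_gt0.
pose rs : seq R := [seq m%:R / (size p)%:R | m <- iota 0 (size p)].
have urs : uniq rs.
  rewrite map_inj_uniq ?iota_uniq// =>
    m m' /(mulIf (invr_neq0 (lt0r_neq0 N0))) /eqP.
  by rewrite eqr_nat => /eqP.
have : ~~ all (root p) rs.
  by apply/negP => h; have := max_poly_roots p0 h urs;
    rewrite size_map size_iota ltnn.
move=> /allPn[_ /mapP[m mI ->] /negP h]; exists (m%:R / (size p)%:R); split.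
  rewrite divr_ge0//= ler_pdivrMr// mul1r ler_nat.
  by move: mI; rewrite mem_iota add0n => /andP[_ /ltnW].
move=> i; apply/eqP => hi; apply: h; apply/rootP; rewrite pE.
by apply/eqP/prodf_eq0; exists i => //; rewrite hi.
Qed.

End LizardHull.

(** * A convex lizard is its own hull *)

Section ConvexLizardHull.
Context {R : realType}.
Implicit Types (x y z d : plane R) (S T L : set (plane R)).

(** If [c - b = m *: (a - b)], then [m <= 0] makes a straight angle at [b], and for [m > 0] two
    consecutive sides overlap. *)
Lemma simple_chain_det_neq0 n (v : 'I_n -> plane R) (i : 'I_n) :
  simple_chain v -> det (v i - v (ordS i)) (v (ordS (ordS i)) - v (ordS i)) !=
    0.
Proof.
move=> [n3 injv disj straight].
have iS : i != ordS i by rewrite eq_sym ordS_neq// ltnW.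
have iSS : i != ordS (ordS i) by rewrite eq_sym ordSS_neq.
have SSS : ordS i != ordS (ordS i) by rewrite eq_sym ordS_neq// ltnW.
set a := v i; set b := v (ordS i); set c := v (ordS (ordS i)).
have ab : a - b != 0 by rewrite subr_eq0; apply: contra iS => /eqP/injv/eqP.
apply/eqP => D0; have [m hm] : exists m : R, c - b = m *: (a - b).
  by apply: det_eq0_collinear => //; rewrite -oppr0 -D0 /det; ring.
have cE : c = b + m *: (a - b) by rewrite -hm addrC subrK.
have [m0|m0] := leP m 0.
  apply: (straight i); apply/segP; exists (1 / (1 - m)); split.
    by rewrite divr_ge0 ?ler_pdivrMr//; lra.
  rewrite -/a -/b -/c cE; apply: plane_eq; rewrite /= /GRing.scale /=; field;
    by apply/eqP => h; lra.
have [m1|m1] := leP m 1.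
  have cs : side v i c.
    apply/segP; exists (1 - m); split; first by apply/andP; split; lra.
    by rewrite -/a -/b cE; apply: plane_eq; rewrite /= /GRing.scale /=; ring.
  have := disj i (ordS i) iS c; case; first by split=> //; exact: seg1.
  by case=> /injv/eqP; rewrite eq_sym ?(negbTE iSS) ?(negbTE SSS).
have ais : side v (ordS i) a.
  apply/segP; exists (1 / m); split; first by rewrite divr_ge0 ?ler_pdivrMr//;
    lra.
  rewrite -/a -/b -/c cE; apply: plane_eq; rewrite /= /GRing.scale /=; field;
    by apply/eqP => h; lra.
have := disj i (ordS i) iS a; case; first by split=> //; exact: seg0.
by move=> _ [] /injv/eqP; rewrite ?(negbTE iSS) ?(negbTE iS).
Qed.

(* The direction from [b = p + t e] to a point [x] on the same side of the base
   as [z] enters the triangle with base [p, p + e] and apex [z]. *)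
Lemma triangle_enter S p e (t : R) z x (m g : R) : convex_set S ->
  S p -> S (p + e) -> S z -> 0 < t < 1 -> 0 < g ->
  x - (p + t *: e) = m *: e + g *: (z - (p + t *: e)) ->
  exists2 s : R, 0 < s <= 1 & S ((p + t *: e) + s *: (x - (p + t *: e))).
Proof.
move=> /convex_setP cS Sp Spe Sz /andP[t0 t1] g0 xE.
pose w := Num.min t (1 - t); pose K := `|m| + g + 1.
have w0 : 0 < w by rewrite lt_min t0 subr_gt0.
have wt : w <= t by rewrite ge_min lexx.
have wt1 : w <= 1 - t by rewrite ge_min lexx orbT.
have m0 := normr_ge0 m.
have K1 : 1 <= K by rewrite /K; lra.
pose s := w / (2 * K).
have s0 : 0 < s by rewrite divr_gt0//; lra.
have sK : s * K = w / 2 by rewrite /s; field; apply/eqP => h; lra.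
have sg : s * g <= 1 / 2.
  have : s * g <= s * K by rewrite ler_pM2l// /K; lra.
  by rewrite sK; lra.
have sm : s * `|m| <= w / 2 by rewrite -sK ler_pM2l// /K; lra.
have s1 : s <= 1 by rewrite (le_trans _ (_ : s * K <= 1))//;
  [rewrite ler_peMr// ltW|rewrite sK; lra].
exists s; first by rewrite s0.
have sgl : 1 - s * g != 0 by apply/eqP => h; lra.
(* The point reached is a combination of [z], with weight [s * g], and of the base point at
   parameter [q]; [s] is so small that [q] moves from [t] by at most [w]. *)
pose q := t + s * m / (1 - s * g).
have q01 : 0 <= q <= 1.
  have h : `|s * m / (1 - s * g)| <= w.
    rewrite normrM normfV normrM (gtr0_norm s0) (@gtr0_norm _ (1 - s * g));
      last lra.
    rewrite ler_pdivrMr; last lra.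
    apply: (le_trans sm); rewrite ler_pM2l//; lra.
  by move: h; rewrite ler_norml => /andP[h1 h2]; apply/andP; split;
    rewrite /q; lra.
have -> : p + t *: e + s *: (x - (p + t *: e)) =
    (1 - s * g) *: ((1 - q) *: p + q *: (p + e)) + (s * g) *: z.
  by rewrite xE; apply: plane_eq; rewrite /q /= /GRing.scale /=; field.
apply: (cS) => //; first exact: cS.
by rewrite mulr_ge0 ?(ltW s0) ?(ltW g0)//=; lra.
Qed.

Variable k : nat.
Hypothesis k2 : (2 <= k)%N.

(** Let [x] be in the hull but not in [S], and let [b] be the last point of [S] from some [y] in [S]
    towards [x]. If [b] is inside a side, the hull condition gives [z] in [S] strictly beyond its
    line, and the triangle on that side with apex [z] lets the walk continue in [S] past [b]. *)
Lemma convex_lizard_hull S : convex_k_lizard k S -> hull k S = S.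
Proof.
move=> [Lz cS]; have cS' := (convex_setP _).1 cS.
have bS := lizard_bounded Lz; have clS := lizard_closed Lz.
apply/seteqP; split; last exact: sub_hull.
move: Lz => [n [v [sv SE dv]]] x hx; apply: contrapT => nSx.
have n3 : (3 <= n)%N by case: sv.
have Sside i p : side v i p -> S p by move=> ip; rewrite SE; left; exists i.
have Sv i : S (v i) by apply: (Sside i); exact: seg0.
have xv i : v i - x != 0 by rewrite subr_eq0; apply: contra_notN nSx => /eqP <-.
(* No vertex is collinear with [x] and both [A] and [B], so a suitable [y] between [A] and [B] keeps
   every vertex off the line through [x] and [y]. *)
have [A [B [SA SB AB]]] : exists A B, [/\ S A, S B & det (A - x) (B - x) != 0].
  apply: contrapT => h.
  have i0 : 'I_n := Ordinal (leq_trans (ltn0Sn 2) n3).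
  have z p q : S p -> S q -> det (p - x) (q - x) = 0.
    move=> Sp Sq; apply/eqP/negPn/negP => h'; apply: h; by exists p, q.
  have := simple_chain_det_neq0 i0 sv.
  set a := v i0; set b := v (ordS i0); set c := v _; move/eqP; apply.
  transitivity (det (a - x) (c - x) - det (a - x) (b - x) -
    det (b - x) (c - x)).
    by rewrite /det /=; ring.
  by rewrite !z ?subrr//; exact: Sv.
have vAB i : (det (v i - x) (A - x) != 0) || (det (v i - x) (B - x) != 0).
  have flip p q : det p q = - det q p by rewrite /det; ring.
  rewrite -negb_and; apply: contra (xv i) => /andP[/eqP h1 /eqP h2]; apply/eqP.
  apply: (det_inj AB); rewrite flip ?h1 ?h2 /det /= !mulr0 subrr ?oppr0//.
have [u [/andP[u0 u1] hu]] := affine_avoid vAB.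
pose y : plane R := (1 - u) *: A + u *: B.
have Sy : S y by apply: cS' => //; rewrite u0.
have {}hu i : det (v i - x) (y - x) != 0.
  apply: contraNneq (hu i) => <-; apply/eqP.
  by rewrite /y /det /= /GRing.scale /=; ring.
have [r [/andP[r0 r1] Sb0 hb]] := last_point clS Sy nSx.
pose b : plane R := (1 - r) *: y + r *: x.
have {Sb0} Sb : S b by [].
have bx : b - x = (1 - r) *: (y - x).
  by rewrite /b; apply: plane_eq; rewrite /= /GRing.scale /=; ring.
have r10 : 1 - r != 0 by apply/eqP; lra.
have bv i : det (v i - x) (b - x) != 0.
  rewrite bx; have -> : det (v i - x) ((1 - r) *: (y - x)) =
    (1 - r) * det (v i - x) (y - x).
    by rewrite /det /= /GRing.scale /=; ring.
  by rewrite mulf_neq0.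
have after (s : R) : 0 < s <= 1 -> ~ S (b + s *: (x - b)).
  move=> /andP[s0 s1] h; apply: (hb (r + s * (1 - r))).
    have := mulr_gt0 s0 (_ : 0 < 1 - r); rewrite subr_gt0 => /(_ r1) h1.
    apply/andP; split; first by lra.
    have : s * (1 - r) <= 1 * (1 - r) by rewrite ler_pM2r ?subr_gt0.
    lra.
  move: h; congr (S _); rewrite /b; apply: plane_eq;
    rewrite /= /GRing.scale /=; ring.
(* Off the curve, [b] would be interior to [S], and the walk could go on. *)
have Cb : chain_curve v b.
  apply: contrapT => nCb; have Ib : S^° b.
    have Sb' : fill (chain_curve v) b by rewrite -[fill _]/(chain_region v) -SE.
    have : (fill (chain_curve v))^° b by apply: fill_interior => //;
      exact: chain_curve_closed.
    by rewrite -[fill _]/(chain_region v) -SE.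
  have [e e0 he] := open_line (x - b) (@open_interior _ S) Ib.
  apply: (after (Num.min (e / 2) 1)).
    by rewrite lt_min ge_min lexx orbT ltr01 !andbT divr_gt0.
  apply: interior_subset; apply: he;
    rewrite gtr0_norm ?lt_min ?divr_gt0 ?ltr01//.
  by rewrite gt_min; apply/orP; left; lra.
have [i _ /segP[t [/andP[t0 t1] bE]]] := Cb.
pose e : plane R := v (ordS i) - v i.
have bE' : b = v i + t *: e.
  by rewrite bE /e; apply: plane_eq; rewrite /= /GRing.scale /=; ring.
have tn0 : t != 0.
  by apply: contraNneq (bv i) => h;
    rewrite bE' h scale0r addr0 /det mulrC subrr.
have tn1 : t != 1.
  apply: contraNneq (bv (ordS i)) => h;
    rewrite bE h subrr scale0r add0r scale1r.
  by rewrite /det mulrC subrr.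
have [theta [_ [q q0 eE]] [j0 j0k thE]] := dv i.
have e0 : e != 0.
  have [_ injv _ _] := sv; rewrite subr_eq0; apply/eqP => /injv/eqP.
  by rewrite (negbTE (ordS_neq _ _))// ltnW.
(* The index [l] is [j0] or [j0 + k], whichever puts [x] beyond the line of the side. *)
have [l [g [g0 gE xl]]] : exists l (g : R), [/\ g != 0, e = g *: dirv k l
    & 0 < det (x - v i) (dirv k l)].
  have d0 : det (x - v i) (dirv k j0) != 0.
    apply: contraNneq (bv i) => h; apply/eqP.
    transitivity (- t * det (x - v i) e);
      first by rewrite bE' /det /= /GRing.scale /=; ring.
    have -> : det (x - v i) e = q * det (x - v i) (dirv k j0).
      rewrite /e eE thE; rewrite /det /= /GRing.scale /=; rewrite /ang; ring.
    by rewrite h !mulr0.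
  move: d0; rewrite neq_lt => /orP[h|h]; last by exists j0, q; split=> //;
    rewrite /e eE thE.
  exists (j0 + k)%N, (- q); split; first by rewrite oppr_eq0.
    by rewrite dirvDk// scaleNr scalerN opprK /e eE thE.
  rewrite dirvDk//; have -> : det (x - v i) (- dirv k j0) =
    - det (x - v i) (dirv k j0).
    by rewrite /det /=; ring.
  by rewrite oppr_gt0.
have [z Sz zl] : exists2 z, S z & det (v i) (dirv k l) < det z (dirv k l).
  apply: support_gt; first by exists y.
  apply: lt_le_trans (hx l); rewrite -subr_gt0.
  by move: xl; congr (0 < _); rewrite /det /=; ring.
have dl0 : (dirv k l : plane R) != 0.
  by apply/eqP => h; move/eqP: e0; apply; rewrite gE h scaler0.
have gz : 0 < det (z - v i) (dirv k l).
  by move: zl; rewrite -subr_gt0; congr (0 < _); rewrite /det /=; ring.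
set zz := det (z - v i) (dirv k l) in gz; set xx :=
  det (x - v i) (dirv k l) in xl.
have [m mE] : exists m : R, x - b - (xx / zz) *: (z - b) = m *: dirv k l.
  apply: det_eq0_collinear => //; rewrite bE' gE.
  have -> : det (x - (v i + t *: (g *: dirv k l)) -
    (xx / zz) *: (z - (v i + t *: (g *: dirv k l)))) (dirv k l)
    = xx - xx / zz * zz by rewrite /xx /zz /det /= /GRing.scale /=; ring.
  by rewrite divfK ?subrr// gt_eqF.
have [||||s s01] := @triangle_enter S (v i) e t z x (m / g) (xx / zz) cS
  (Sv i) _ Sz.
- by rewrite /e addrC subrK; exact: Sv.
- by rewrite lt_neqAle eq_sym tn0 t0 lt_neqAle tn1.
- by rewrite divr_gt0.
- by rewrite -bE' gE scalerA divfK// -mE subrK.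
by rewrite -bE'; exact: after.
Qed.

End ConvexLizardHull.

(** * Existence of scales *)

Section Scales.
Context {R : realType}.
Implicit Types (p q x y z d : plane R) (S T L : set (plane R)).

Lemma interior_convex S : convex_set S -> convex_set S^°.
Proof.
move=> /convex_setP cS; apply/convex_setP => x y t.
move=> /nbhs_squareP[e e0 he] /nbhs_squareP[e' e'0 he'] t01; apply/nbhs_squareP.
exists (Num.min e e'); first by rewrite lt_min e0.
move=> q; rewrite !lt_min => /andP[h1 h2] /andP[h3 h4].
pose w := q - ((1 - t) *: x + t *: y).
have -> : q = (1 - t) *: (x + w) + t *: (y + w).
  by rewrite /w; apply: plane_eq; rewrite /= /GRing.scale /=; ring.
by apply: cS => //; [apply: he|apply: he']; rewrite /= addrAC subrr add0r.
Qed.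

Variable k : nat.
Hypothesis k2 : (2 <= k)%N.

Lemma interior_support S y i : bounded_set S -> S^° y ->
  det y (dirv k i) < support k S i.
Proof.
move=> bS yS; pose u : plane R := ((dirv k i).2, - (dirv k i).1).
have [e e0 he] := open_line1 u (@open_interior _ S) yS.
apply: lt_le_trans (support_ge k i bS (interior_subset he)).
have -> : det (y + e *: u) (dirv k i) =
  det y (dirv k i) + e * (cos (ang k i) ^+ 2 + sin (ang k i) ^+ 2).
  by rewrite /u /dirv /det /= /GRing.scale /=; ring.
by rewrite cos2Dsin2 mulr1 ltrDl.
Qed.

(* The union of a chain of convex lizards need not be closed, but its hull is an
   upper bound: a point strictly inside the hull satisfies finitely many strict
   inequalities, so it lies in some member of the chain. *)
Lemma scale_exists L T0 y : k_lizard k L -> convex_k_lizard k T0 -> T0 `<=` L ->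
  T0^° y -> exists2 S, scale k L S & T0 `<=` S.
Proof.
move=> Lz T0z T0L yT0.
have cL := lizard_closed Lz; have bL := lizard_bounded Lz.
have bsub S : S `<=` L -> bounded_set S.
  move=> SL; have [r hr] := (bounded_planeP _).1 bL.
  by apply/bounded_planeP; exists r => x /SL/hr.
pose P S := [/\ convex_k_lizard k S, T0 `<=` S & S `<=` L].
have PT0 : P T0 by split.
have [||||S Smax] := @Zorn {S | P S} (fun X Y => `[< sval X `<=` sval Y >]).
- by move=> S; exact/asboolP.
- by move=> S T U /asboolP ST /asboolP TU; apply/asboolP;
  exact: subset_trans TU.
- by move=> [S PS] [T PT] /asboolP /= ST /asboolP /= TS; apply: eq_exist;
  exact/seteqP.
- move=> F Ftot; have [[S0 FS0]|nF] := pselect (exists X, F X); last first.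
    by exists (exist _ T0 PT0) => S FS; case: nF; exists S.
  pose U := \bigcup_(X in F) sval X.
  have FU X : F X -> sval X `<=` U by move=> FX x Xx; exists X.
  have UL : U `<=` L by move=> x [S _]; have [_ _] := svalP S; exact.
  have T0U : T0 `<=` U by apply: subset_trans (FU _ FS0); case: (svalP S0).
  have bU := bsub _ UL; have U0 : U !=set0 by exists y; apply: T0U;
    exact: interior_subset.
  have yU i : det y (dirv k i) < support k U i.
    apply: lt_le_trans (interior_support i (bsub _ T0L) yT0) _.
    apply: support_le => [|x T0x]; first by exists y; exact: interior_subset.
    by apply: support_ge => //; exact: T0U.
  (* A point of the hull outside the closed set [L] could be moved slightly towards [y] without
     entering [L]; the new point [z] meets every constraint strictly. *)
  have HL : hull k U `<=` L.
    move=> x Hx; apply: contrapT => nLx.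
    have [e e0 he] := open_line (y - x) (closed_openC cL) nLx.
    pose s := Num.min (e / 2) (1 / 2).
    have s0 : 0 < s by rewrite lt_min !divr_gt0.
    have s1 : s < 1 by rewrite gt_min; apply/orP; right; lra.
    have se : s < e by rewrite gt_min; apply/orP; left; lra.
    apply: (he s); first by rewrite gtr0_norm.
    set z : plane R := x + s *: (y - x).
    have zU i : det z (dirv k i) < support k U i.
      have -> : det z (dirv k i) = (1 - s) * det x (dirv k i) +
        s * det y (dirv k i).
        by rewrite /z /det /= /GRing.scale /=; ring.
      have -> : support k U i = (1 - s) * support k U i +
        s * support k U i by ring.
      apply: ler_ltD; last by rewrite ltr_pM2l.
      by apply: ler_wpM2l; [lra|exact: Hx].
    (* One constraint at a time: of the member found so far and a member meeting the new constraint,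
       the larger one meets them all. *)
    have [S FS zS] : exists2 X, F X &
        forall i, (i < k + k)%N -> det z (dirv k i) <= support k (sval X) i.
      elim: (k + k)%N => [|m [S FS IH]]; first by exists S0.
      have [x' [S' FS' S'x'] zx'] := support_gt U0 (zU m).
      have [SS'|S'S] := Ftot S S' FS FS'.
        exists S' => // i; rewrite ltnS leq_eqVlt => /orP[/eqP ->|im].
          by apply: (le_trans (ltW zx')); apply: support_ge => //;
            apply: bsub; case: (svalP S').
        apply: (le_trans (IH i im)); apply: support_le => [|w Sw].
          by exists y; case: (svalP S) => _ + _; apply; exact: interior_subset.
        apply: support_ge; last by move/asboolP: SS'; exact.
        by apply: bsub; case: (svalP S').
      exists S => // i; rewrite ltnS leq_eqVlt => /orP[/eqP ->|im];
        last exact: IH.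
      apply: (le_trans (ltW zx')); apply: support_ge;
        last by move/asboolP: S'S; exact.
      by apply: bsub; case: (svalP S).
    have [Sz _ SL] := svalP S.
    apply: SL; rewrite -(convex_lizard_hull k2 Sz) => i.
    elim/ltn_ind: i => i IH; have [|ki] := ltnP i (k + k); first exact: zS.
    rewrite -(subnK ki) dirvD2k// support_per//; apply: IH.
    by rewrite ltn_subrL addn_gt0 (ltnW k2)/= (leq_trans _ ki)// addn_gt0
      (ltnW k2).
  have PH : P (hull k U).
    split=> //; last by apply: subset_trans T0U _; exact: sub_hull.
    exact: (hull_lizard k2 bU U0 yU (bsub _ HL)).
  exists (exist _ _ PH) => S FS; apply/asboolP => /=.
  by apply: subset_trans (FU _ FS) _; exact: sub_hull.
exists (sval S); last by case: (svalP S).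
case: (svalP S) => Sz T0S SL; split=> // T Tz ST TL.
have PT : P T by split=> //; exact: subset_trans ST.
by rewrite -(Smax (exist _ T PT) (asboolT ST)).
Qed.

(** The lizard is the regular polygon with [k + k] sides, centre [p] and inradius [w]. *)
Lemma small_lizard p L : L^° p -> exists T,
  [/\ convex_k_lizard k T, T `<=` L & T^° p].
Proof.
move=> /nbhs_squareP[e e0 he].
have s1 := @sin_ang1 R k k2.
(* Directions 0 and 1 bound the second coordinate by [w] and the first by [2 * w / sin (ang k 1)],
   which this choice makes [e / 2]. *)
pose w := e * sin (ang k 1) / 4.
have w0 : 0 < w by rewrite !(divr_gt0, mulr_gt0).
pose c i := det p (dirv k i) + w.
have sq x : half_planes k c x -> `|(x.1 : R) - p.1| < e /\ `|(x.2 : R) - p.2|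
  < e.
  move=> hx; pose a := (x.1 : R) - p.1; pose b := (x.2 : R) - p.2.
  have det_sub i : det x (dirv k i) - det p (dirv k i) =
    a * sin (ang k i) - b * cos (ang k i).
    by rewrite /a /b /det /=; ring.
  have hl i : a * sin (ang k i) - b * cos (ang k i) <= w.
    by rewrite -det_sub lerBlDl; exact: hx.
  have hg i : - w <= a * sin (ang k i) - b * cos (ang k i).
    by have := hl (i + k)%N; rewrite sin_angDk// cos_angDk//; lra.
  have h0 := hl 0%N; have h0' := hg 0%N; have h1 := hl 1%N; have h1' := hg 1%N.
  rewrite ang0 sin0 cos0 mulr0 mulr1 sub0r in h0 h0'.
  have c0 := @cos_ang1 R k k2; have c1 := cos_le1 (ang k 1 : R).
  have sle := sin_le1 (ang k 1 : R).
  have we : w <= e / 4.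
    by rewrite /w ler_pM2r ?invr_gt0// -[leRHS]mulr1 ler_pM2l.
  have hb : `|b| <= w by rewrite ler_norml; apply/andP; split; lra.
  have hbc : `|b * cos (ang k 1)| <= w.
    rewrite normrM (ger0_norm c0); apply: le_trans hb; by rewrite ler_piMr.
  move: (hbc); rewrite ler_norml => /andP[hb1 hb2].
  split; last by apply: (le_lt_trans hb); lra.
  have : `|a| * sin (ang k 1) <= 2 * w.
    rewrite -[sin _]gtr0_norm// -normrM ler_norml; apply/andP; split; lra.
  have -> : 2 * w = e / 2 * sin (ang k 1) by rewrite /w; field.
  by rewrite ler_pM2r// -/a => h; apply: (le_lt_trans h); lra.
exists (half_planes k c); split.
- apply: (@half_planes_lizard _ k c p k2).
  + by move=> i; rewrite /c dirvD2k.
  + move=> i; have := det_dirvSS k p i; rewrite /c => h.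
    have := cos_le1 (ang k 1 : R); have : 0 <= (1 - cos (ang k 1 : R)) * w.
      by rewrite mulr_ge0 ?subr_ge0 ?cos_le1// ltW.
    lra.
  + by move=> i; rewrite /c ltrDl.
  + apply/bounded_planeP; exists (`|p.1 : R| + `|p.2 : R| + e) => x /sq[h1 h2].
    have := normr_ge0 (p.1 : R); have := normr_ge0 (p.2 : R) => n2 n1.
    split.
      have := ler_normD ((x.1 : R) - p.1) p.1; rewrite subrK; lra.
    have := ler_normD ((x.2 : R) - p.2) p.2; rewrite subrK; lra.
- by move=> x /sq[]; exact: he.
- apply/nbhs_squareP; exists (w / 2); first by rewrite divr_gt0.
  move=> q h1 h2 i; rewrite /c -lerBlDl.
  have -> : det q (dirv k i) - det p (dirv k i) =
      ((q.1 : R) - p.1) * sin (ang k i) - ((q.2 : R) - p.2) * cos (ang k i).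
    by rewrite /det /=; ring.
  apply: (le_trans (ler_norm _)); apply: (le_trans (ler_normB _ _));
    rewrite !normrM.
  have -> : w = w / 2 * 1 + w / 2 * 1 by lra.
  by apply: lerD; apply: ler_pM; rewrite ?normr_ge0 ?sin_max ?cos_max// ltW.
Qed.

End Scales.

Theorem theorem3p4 (R : realType) (j k : nat) (hj : (4 <= j)%N)
  (hk : (2 <= k)%N) :
  ~ k_MSP_graph R k (cycle_graph j).
Proof.
move=> [L [Lz [f [[fsub _ fsurj] fadj]]]].
have fscale i : scale k L (f i) by exact: fsub.
apply: (@cyclic_nerve_hole R j (fun i => (f i)^°) (~` L) hj).
- by move=> i; exact: open_interior.
- by move=> i; apply: interior_convex; case: (fscale i) => -[].
- move=> i; have [[/lizard_bounded/bounded_planeP[r hr] _] _ _] := fscale i.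
  by apply/bounded_planeP; exists r => x /interior_subset/hr.
- by move=> i l il; exact: fadj.
- exact: lizardC_connected Lz.
(* What remains is that the interiors of the scales cover exactly the interior of [L]. *)
- rewrite closure_setC; congr (~` _); apply/seteqP; split=> x; last first.
    by move=> [i _]; apply: interiorS; case: (fscale i).
  move=> /(small_lizard hk)[T [Tz TL xT]].
  have [S Sscale TS] := scale_exists hk Lz Tz TL xT.
  have [i _ fiS] := fsurj S Sscale.
  by exists i => //; rewrite fiS; exact: interiorS xT.
Qed.
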